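(* For any fixed $k$ sufficiently large, any algorithm achieving an approximation ratio better than $1.268$ for the Symmetric Submodular Multiway Partition problem with $k$ terminals in the value oracle model requires exponentially many value queries.
   Context: Symmetric Submodular Multiway Partition: given a finite ground set $V$, a nonnegative submodular function $f:2^V\to\mathbb{R}_+$ that is symmetric ($f(S)=f(V\setminus S)$ for all $S$), accessible only through a value oracle, and $k$ distinct terminals $t_1,\ldots,t_k\in V$, find a partition $A_1,\ldots,A_k$ of $V$ with $t_i\in A_i$ minimizing $\sum_{i=1}^k f(A_i)$. ''Exponentially many'' means exponential in the size of the ground set. *)

(* Defs.v *)
From mathcomp Require Import all_boot all_order all_algebra.
From mathcomp Require Import reals.
From Stdlib Require List.
Set Implicit Arguments. Unset Strict Implicit. Unset Printing Implicit Defensive.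
Import Order.TTheory GRing.Theory Num.Theory.
Local Open Scope ring_scope.

Section SSMP.
Variables (R : realType) (n k : nat).

Definition nonneg_setfun (f : {set 'I_n} -> R) := forall S, 0 <= f S.
Definition submodular (f : {set 'I_n} -> R) :=
  forall A B, f (A :|: B) + f (A :&: B) <= f A + f B.
Definition symmetric_setfun (f : {set 'I_n} -> R) := forall S, f S = f (~: S).

Definition ssmp_fun (f : {set 'I_n} -> R) :=
  [/\ nonneg_setfun f, submodular f & symmetric_setfun f].

Definition part (L : {ffun 'I_n -> 'I_k}) (i : 'I_k) : {set 'I_n} :=
  [set v | L v == i].
Definition feasible (t : 'I_k -> 'I_n) (L : {ffun 'I_n -> 'I_k}) :=
  forall i, L (t i) = i.
Definition cost (f : {set 'I_n} -> R) (L : {ffun 'I_n -> 'I_k}) : R :=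
  \sum_(i < k) f (part L i).

(* A deterministic algorithm in the value oracle model: an (infinitely
   branching) decision tree.  [Query S c] asks for f S and continues with
   c (f S); [Output L] returns the partition encoded by L. *)
Inductive oracle_tree : Type :=
| Output of {ffun 'I_n -> 'I_k}
| Query of {set 'I_n} & (R -> oracle_tree).

Fixpoint run (f : {set 'I_n} -> R) (T : oracle_tree) : {ffun 'I_n -> 'I_k} :=
  match T with
  | Output L => L
  | Query Q c => run f (c (f Q))
  end.

Fixpoint queries (f : {set 'I_n} -> R) (T : oracle_tree) : nat :=
  match T with
  | Output _ => 0
  | Query Q c => (queries f (c (f Q))).+1
  end.

(* A (possibly randomized) algorithm: given the terminals, a finitely
   supported probability distribution over deterministic decision trees,
   given as a list of (weight, tree) pairs.  Deterministic algorithms are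
   the case of a single pair (1, T). *)
Definition rand_alg := ('I_k -> 'I_n) -> seq (R * oracle_tree).

Definition is_distr (d : seq (R * oracle_tree)) :=
  (forall p, Stdlib.Lists.List.In p d -> 0 <= p.1) /\ \sum_(p <- d) p.1 = 1.

Definition expected_cost (f : {set 'I_n} -> R) (d : seq (R * oracle_tree)) : R :=
  \sum_(p <- d) p.1 * cost f (run f p.2).

Definition approx_alg (A : rand_alg) (alpha : R) :=
  forall (t : 'I_k -> 'I_n) (f : {set 'I_n} -> R),
    injective t -> ssmp_fun f ->
    [/\ is_distr (A t),
        (forall p, Stdlib.Lists.List.In p (A t) -> 0 < p.1 -> feasible t (run f p.2)) &
        forall L, feasible t L -> expected_cost f (A t) <= alpha * cost f L].

End SSMP.

(* Main.v *)
Require Import Defs.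
From mathcomp Require Import all_boot all_order all_algebra.
From mathcomp Require Import reals.
From Stdlib Require List.
From mathcomp Require Import ring lra.
(** Symmetry gap.  The ground set has terminals and, for every unordered pair
  {i, j} of labels, a large block of elements, half of which secretly belong to
  i and half to j.  A planted function is cheap on the secret partition, while
  every set queried without knowledge of the secret meets the two halves of each
  block almost equally (up to exponentially small probability), and on such sets
  the planted function equals a public function that does not depend on the
  secret.  So few queries only find a partition as expensive as the optimum of
  the public function.

  Both functions are sums of "stars" (label i against the blocks {i, j}: a tent
  function of the fraction taken, of slope beta and -beta) and of "cliques"
  (hyperedge cuts of the 28 blocks spanned by 8 random labels).  Per label, the
  secret partition costs 1 + beta + 1/4, and every partition costs at least
  4 - O(1/k) for the public function.  Stars alone would give at best the gap
  3 - sqrt 3 = 1.26795, attained for 1 + beta = 2 + 2 / sqrt 3; the cliques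
  charge for the number of labels in use and allow a smaller total weight,
  with gap 4 / (5/4 + 219/115) > 1.26808.

  For the lower bound, the tents are replaced by their linear pieces.  This puts
  each label i in one of three classes: B (i keeps a large part of its star),
  G (it keeps little), X (one other label takes most of the star of i).  Once
  the classes are fixed the cost is linear in the assignment and can be minimized
  pair by pair; averaging over 8-tuples of labels leaves a polynomial inequality
  in the proportions s, v, x of the classes B, G, X. *)

Set Implicit Arguments. Unset Strict Implicit. Unset Printing Implicit Defensive.
Import Order.TTheory GRing.Theory Num.Theory.
Local Open Scope ring_scope.

(** * The polynomial inequality *)

Section Poly.
Variable R : realFieldType.
Implicit Types s v x a : R.

(* With clique weight 1/4, [mean_cost_bound] needs beta > 1.90417 and a gap above
   1.268 needs beta < 1.90457. *)
Definition star_weight : R := 219 / 115.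
Local Notation beta := star_weight.

(* The expectation of [label_count] below for 8 independent labels of class B, G, X
   with probabilities s, v, 1 - s - v. *)
Definition mean_count s v : R :=
  8 * (s * (s + v) ^+ 7) + (s + v) ^+ 8 - 2 * s ^+ 8 - 8 * (v * s ^+ 7) - v ^+ 8.

Lemma mean_count_ge0 s v : 0 <= s -> 0 <= v -> 0 <= mean_count s v.
Proof.
move=> s0 v0; rewrite /mean_count.
have -> : 8 * (s * (s + v) ^+ 7) + (s + v) ^+ 8 - 2 * s ^+ 8 - 8 * (v * s ^+ 7) - v ^+ 8 =
  7 * s^+8 + 56 * (s^+7*v) + 196 * (s^+6*v^+2) + 336 * (s^+5*v^+3) + 350 * (s^+4*v^+4)
  + 224 * (s^+3*v^+5) + 84 * (s^+2*v^+6) + 16 * (s*v^+7) by ring.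
by rewrite !addr_ge0 // ?mulr_ge0 // ?exprn_ge0 // ?ler0n.
Qed.

Lemma bernoulli_le n x : 0 <= x <= 1 -> 1 - n%:R * x <= (1 - x) ^+ n.
Proof.
move=> /andP[x0 x1]; elim: n => [|n IH]; first by rewrite expr0 mul0r subr0.
have h : (1 - x) * (1 - n%:R * x) <= (1 - x) ^+ n.+1.
  by rewrite exprS ler_wpM2l ?subr_ge0.
apply: le_trans h; rewrite -natr1.
have h1 : 0 <= n%:R :> R by [].
nra.
Qed.

(** Bernoulli on (1 - x)^7 and (1 - x)^8 makes the positive terms linear in x; the subtracted terms
    can only grow when x is set to 0. *)
Lemma bernoulli_mean_count s x : 0 <= s -> 0 <= x -> s + x <= 1 ->
  8 * s + 1 - 2 * s ^+ 8 - 8 * ((1 - s) * s ^+ 7) - (1 - s) ^+ 8 - (56 * s + 8) * x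
  <= mean_count s (1 - s - x).
Proof.
move=> s0 x0 sx; rewrite /mean_count.
have -> : s + (1 - s - x) = 1 - x by ring.
have hx : 0 <= x <= 1 by apply/andP; split; lra.
have h7 := bernoulli_le 7 hx; have h8 := bernoulli_le 8 hx.
have s7 : 0 <= s ^+ 7 by rewrite exprn_ge0.
have hs7 : s * (1 - 7 * x) <= s * (1 - x) ^+ 7 by rewrite ler_wpM2l.
have hv : (1 - s - x) ^+ 8 <= (1 - s) ^+ 8 by rewrite lerXn2r ?nnegrE //; lra.
have hm : (1 - s - x) * s ^+ 7 <= (1 - s) * s ^+ 7 by rewrite ler_wpM2r //; lra.
lra.
Qed.

(* A tangent parabola at 18/25: the function bounded here is convex on [0, 1]. *)
Lemma tangent_bound s : 0 <= s <= 1 ->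
  8 * s ^+ 7 - 6 * s ^+ 8 <= 
  (8 * (18/25) ^+ 7 - 6 * (18/25) ^+ 8) 
  + (56 * (18/25) ^+ 6 - 48 * (18/25) ^+ 7) * (s - 18/25) + 19 * (s - 18/25) ^+ 2.
Proof.
move=> /andP[s0 s1].
pose a : R := 18/25.
(* [q] is the remainder beyond the tangent at [a], divided by (s - a)^2. Grouping it by the products
   s^i (8 - 6 s) lets each be bounded separately, giving q <= 19. *)
pose q : R := s^+5*(8-6*s) + 2*a*(s^+4*(8-6*s)) + 3*a^+2*(s^+3*(8-6*s))
  + 4*a^+3*(s^+2*(8-6*s)) + 5*a^+4*(s*(8-6*s)) + 6*a^+5*(8-6*s) - 42*a^+6.
have -> : 8 * s ^+ 7 - 6 * s ^+ 8 = (8 * a ^+ 7 - 6 * a ^+ 8) 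
  + (56 * a ^+ 6 - 48 * a ^+ 7) * (s - a) + q * (s - a) ^+ 2 by rewrite /q; ring.
rewrite lerD2l ler_wpM2r ?sqr_ge0 //.
have h1 : s * (8 - 6 * s) <= 8/3 by have := sqr_ge0 (s - 2/3); lra.
have h2 : s^+2 * (8 - 6 * s) <= 8/3.
  by rewrite expr2 -mulrA (le_trans _ h1) // ler_piMl // mulr_ge0 //; lra.
have h3 : s^+3 * (8 - 6 * s) <= 2.
  have -> : s^+3*(8-6*s) = 2 - 2*(1-s)^+2*(1+2*s+3*s^+2) by ring.
  have : 0 <= (1-s)^+2*(1+2*s+3*s^+2) by rewrite mulr_ge0 ?sqr_ge0 //; nra.
  lra.
have h4 : s^+4 * (8 - 6 * s) <= 2.
  by rewrite exprS -mulrA (le_trans _ h3) // ler_piMl // mulr_ge0 ?exprn_ge0 //; lra.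
have h5 : s^+5 * (8 - 6 * s) <= 2.
  by rewrite exprS -mulrA (le_trans _ h4) // ler_piMl // mulr_ge0 ?exprn_ge0 //; lra.
rewrite /q /a; lra.
Qed.

(** The case x = 0 of [mean_cost_bound] for large s. Bounding the terms of high degree by quadratics
    leaves a quadratic with its minimum near 13/18. *)
Lemma no_heavy_bound s : 14/25 <= s <= 1 ->
  2 <= (1 + beta) * (1 - s) + beta * s ^+ 2 
    + 1/32 * (8 * s + 1 - 2 * s ^+ 8 - 8 * ((1 - s) * s ^+ 7) - (1 - s) ^+ 8).
Proof.
move=> /andP[s0 s1].
have s01 : 0 <= s <= 1 by apply/andP; split; lra.
have h := tangent_bound s01.
have h8 : (1 - s) ^+ 8 <= (11/25) ^+ 6 * (1 - s) ^+ 2.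
  rewrite (exprD (1 - s) 6 2) ler_wpM2r ?sqr_ge0 // lerXn2r ?nnegrE //; lra.
rewrite /star_weight.
suff : 0 <= 32 * ((1 + 219/115) * (1 - s) + 219/115 * s ^+ 2 - 2) + 8 * s + 1 - (11/25) ^+ 6 * (1 - s) ^+ 2
   - ((8 * (18/25) ^+ 7 - 6 * (18/25) ^+ 8) 
  + (56 * (18/25) ^+ 6 - 48 * (18/25) ^+ 7) * (s - 18/25) + 19 * (s - 18/25) ^+ 2) by lra.
have := sqr_ge0 (s - 13/18); lra.
Qed.

(** Twice the right side bounds the cost per label from below, up to O(1/k). With v eliminated, the
    star part is linear in x with slope 1 + beta - 2 beta (1 - s). *)
Lemma mean_cost_bound s v x : 0 <= s -> 0 <= v -> 0 <= x -> s + v + x = 1 ->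
  2 <= (1 + beta) * v + 2 * (1 + beta) * x + beta * s ^+ 2 - 2 * beta * (v * x) 
     - 2 * beta * x ^+ 2 + 1/32 * mean_count s v.
Proof.
move=> s0 v0 x0 svx.
have Q0 := mean_count_ge0 s0 v0.
have sx : s + x <= 1 by lra.
have QB := bernoulli_mean_count s0 x0 sx.
have Ev : v = 1 - s - x by lra.
rewrite -{}Ev in QB.
have -> : (1 + beta) * v + 2 * (1 + beta) * x + beta * s ^+ 2 - 2 * beta * (v * x) 
     - 2 * beta * x ^+ 2 = (1 + beta) * (1 - s) + beta * s ^+ 2 + (1 + beta - 2 * beta * (1 - s)) * x.
  have -> : v = 1 - s - x by lra.
  ring.
(* For s <= 6/25 the slope may be negative and x <= 1 - s is used; up to 43/100 it is nonnegative
   and the stars suffice with x dropped. *)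
case: (lerP s (6/25)) => [s23|s23].
  have : 0 <= (6/25 - s) * (1 - s - x) by rewrite mulr_ge0 //; lra.
  have : 0 <= s * (6/25 - s) by rewrite mulr_ge0 //; lra.
  have := mulr_ge0 s0 x0.
  rewrite /star_weight; lra.
case: (lerP s (43/100)) => [s43|s43].
  have : 0 <= (1 + beta - 2 * beta * (1 - s)) * x by rewrite mulr_ge0 //; rewrite /star_weight; lra.
  have : 0 <= (43/100 - s) * (1 - s) by rewrite mulr_ge0 //; lra.
  rewrite /star_weight; lra.
(* Above 57/100 the slope exceeds the Bernoulli loss (56 s + 8) / 32, so the case x = 0 decides. In
   between, Bernoulli serves for x <= 2/5 and the stars alone for larger x. *)
case: (lerP s (57/100)) => [s56|s56]; last first.
  have s561 : 14/25 <= s <= 1 by apply/andP; split; lra.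
  have h := no_heavy_bound s561.
  have : 0 <= (1 + beta - 2 * beta * (1 - s) - (56 * s + 8)/32) * x by rewrite mulr_ge0 //; rewrite /star_weight; lra.
  lra.
have s7 : s ^+ 7 <= (57/100) ^+ 7 by rewrite lerXn2r ?nnegrE //; lra.
have v8 : (1 - s) ^+ 8 <= (57/100) ^+ 8 by rewrite lerXn2r ?nnegrE //; lra.
have s70 : 0 <= s ^+ 7 by rewrite exprn_ge0.
have s8 : 2 * s ^+ 8 + 8 * ((1 - s) * s ^+ 7) <= 8 * s ^+ 7.
  by rewrite exprS; nra.
have sq := sqr_ge0 (s - 1/2).
have sq7 := sqr_ge0 (s - 19/25).
rewrite /star_weight; case: (lerP x (2/5)) => [x4|x4].
  have : 0 <= (2/5 - x) * (57/100 - s) by rewrite mulr_ge0 //; lra.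
  lra.
have : 0 <= (x - 2/5) * (1 + 219/115 - 2 * (219/115) * (1 - s)) by rewrite mulr_ge0 //; lra.
lra.
Qed.

End Poly.

(** * Labels in use on a clique *)

(** Truncation at [h] is subadditive on nonnegative numbers. *)
Lemma sum_min_ge (R : realFieldType) (I : finType) (P : pred I) (h : R) (f : I -> R) : 0 <= h -> (forall i, 0 <= f i) ->
  Num.min (\sum_(i | P i) f i) h <= \sum_(i | P i) Num.min (f i) h.
Proof.
move=> h0 f0; suff [] : 0 <= \sum_(i | P i) f i /\
   Num.min (\sum_(i | P i) f i) h <= \sum_(i | P i) Num.min (f i) h by [].
elim/big_rec2: _ => [|i y x Pi [x0 hxy]]; first by rewrite min_l.
have fi := f0 i; split; first lra.
suff : Num.min (f i + x) h <= Num.min (f i) h + Num.min x h by lra.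
by case: (leP (f i + x) h); case: (leP (f i) h); case: (leP x h); lra.
Qed.

Section Tuple.
(* [z l i j] is the fraction of the elements (i, j, _) that receive label l. *)
Variables (R : realFieldType) (k : nat) (z : 'I_k -> 'I_k -> 'I_k -> R).
Hypothesis z_ge0 : forall l i j, 0 <= z l i j.
Hypothesis z_sum : forall i j, \sum_l z l i j = 1.
Variables B G X : pred 'I_k.
Hypothesis BGX : forall i, [|| [&& B i, ~~ G i & ~~ X i], [&& ~~ B i, G i & ~~ X i] | [&& ~~ B i, ~~ G i & X i]].

(* The fraction of the elements (i, j, _) whose label is not optimal for the
   linearized stars; each costs 2 beta more than an optimal one. *)
Definition dev i j : R :=
  if i == j then 0 else
  if B i then (if B j then 1 - z i i j - z j i j else if G j then 1 - z i i j else 0)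
  else if G i && B j then 1 - z j i j else 0.

Lemma z_le1 l i j : z l i j <= 1.
Proof. by rewrite -(z_sum i j) (bigD1 l) //= lerDl sumr_ge0. Qed.

Lemma z2_le1 l m i j : l != m -> z l i j + z m i j <= 1.
Proof.
move=> lm; rewrite -(z_sum i j) (bigD1 l) //= lerD2l (bigD1 m) 1?eq_sym //= lerDl.
by rewrite sumr_ge0.
Qed.

Lemma z3_le1 l m p i j : l != m -> l != p -> m != p -> z l i j + z m i j + z p i j <= 1.
Proof.
move=> lm lp mp; rewrite -(z_sum i j) (bigD1 l) //= -addrA lerD2l.
rewrite (bigD1 m) 1?eq_sym //= lerD2l (bigD1 p) ?lerDl ?sumr_ge0 //.
by rewrite eq_sym lp eq_sym mp.
Qed.

Lemma dev_ge0 i j : 0 <= dev i j.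
Proof.
rewrite /dev; case: eqP => // /eqP ij; case: (B i); case: (B j); case: (G i); case: (G j) => //=;
have := z2_le1 i j ij; have := z_le1 i i j; have := z_le1 j i j; lra.
Qed.

(* The load of a label ranges over [0, 112], where 112 = 2 * 8 * 7; this is
   min (1, u, 112 - u), a hyperedge cut with a linear ramp at both ends. *)
Definition cutsize (u : R) : R := Num.min 1 u + Num.min 1 (112 - u) - 1.

Variable e : 'I_8 -> 'I_k.

Definition load l : R := 2 * \sum_a \sum_(b | b != a) z l (e a) (e b).
Definition stray a b : R := \sum_(c | (c != a) && (c != b)) z (e c) (e a) (e b).
Definition collide : R := \sum_a \sum_(b | b != a) (e a == e b)%:R.
(* If no class is X and some class is B, this is #B + [#G >= 2] - [#G = 0];
   otherwise it is 0.  The products make its mean over all tuples computable. *)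
Definition label_count : R :=
  \sum_a ((B (e a))%:R * \prod_(c | c != a) (~~ X (e c))%:R) + \prod_a (~~ X (e a))%:R
  - 2 * \prod_a (B (e a))%:R
  - \sum_a ((G (e a))%:R * \prod_(c | c != a) (B (e c))%:R) - \prod_a (G (e a))%:R.

Lemma stray_ge0 a b : 0 <= stray a b.
Proof. by rewrite sumr_ge0. Qed.

Lemma load_ge0 l : 0 <= load l.
Proof. by rewrite mulr_ge0 // sumr_ge0 // => a _; rewrite sumr_ge0. Qed.

Lemma sum_pairs_const (x : R) : \sum_(a < 8) \sum_(b < 8 | b != a) x = 56 * x.
Proof.
have -> : \sum_(a < 8) \sum_(b < 8 | b != a) x = \sum_(a < 8) (7 * x).
  apply: eq_bigr => a _; rewrite sumr_const.
  have -> : #|[pred b : 'I_8 | b != a]| = 7 by rewrite cardC1 card_ord.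
  by rewrite mulr_natl.
rewrite sumr_const card_ord -mulr_natl; ring.
Qed.

Lemma load_sum : \sum_l load l = 112.
Proof.
rewrite -mulr_sumr exchange_big /=.
under eq_bigr => a _ do rewrite exchange_big /=.
under eq_bigr => a _ do under eq_bigr => b _ do rewrite z_sum.
rewrite sum_pairs_const; lra.
Qed.

Lemma load_le l : load l <= 112.
Proof. by rewrite -load_sum (bigD1 l) //= lerDl sumr_ge0 // => m _; apply: load_ge0. Qed.

Lemma cutsize_ge0 (u : R) : 0 <= u <= 112 -> 0 <= cutsize u.
Proof.
move=> /andP[u0 u1]; rewrite /cutsize.
by case: (leP 1 u) => h1; case: (leP 1 (112 - u)) => h2; lra.
Qed.

Lemma sum_star (p : 'I_8 -> 'I_8 -> R) (c : 'I_8) : (forall a b, 0 <= p a b) ->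
  \sum_(j | j != c) (p c j + p j c) <= \sum_a \sum_(b | b != a) p a b.
Proof.
move=> p0; rewrite big_split [leRHS](bigD1 c) //= lerD2l.
by apply: ler_sum => j jc; rewrite (bigD1 c) 1?eq_sym //= lerDl sumr_ge0.
Qed.

Lemma load_ge_pair l a b : a != b -> 2 * (z l (e a) (e b) + z l (e b) (e a)) <= load l.
Proof.
move=> ab; rewrite ler_pM2l //.
have h := sum_star (p := fun a b => z l (e a) (e b)) a (fun _ _ => z_ge0 _ _ _).
apply: le_trans h; rewrite (bigD1 b) 1?eq_sym //= lerDl sumr_ge0 // => *.
by rewrite addr_ge0.
Qed.

(** The fractions not given to [l] total (112 - load) / 2 over the 56 ordered pairs, so a load near
    112 forces [l] to dominate every pair. *)
Lemma load_ge_pairC l a b : a != b ->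
  (1 - z l (e a) (e b)) + (1 - z l (e b) (e a)) <= (112 - load l) / 2.
Proof.
move=> ab.
have h := sum_star (p := fun a b => 1 - z l (e a) (e b)) a.
have {}h := h (fun _ _ => _).
have : (1 - z l (e a) (e b)) + (1 - z l (e b) (e a)) <= \sum_a \sum_(b | b != a) (1 - z l (e a) (e b)).
  apply: le_trans (h _) => [|u v]; last by rewrite subr_ge0 z_le1.
  rewrite (bigD1 b) 1?eq_sym //= lerDl sumr_ge0 // => c _.
  by rewrite addr_ge0 // subr_ge0 z_le1.
have -> : \sum_a \sum_(b | b != a) (1 - z l (e a) (e b)) = 56 - \sum_a \sum_(b | b != a) z l (e a) (e b).
  under eq_bigr => u _ do rewrite sumrB.
  by rewrite sumrB sum_pairs_const mulr1.
rewrite /load; lra.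
Qed.

Lemma cutsize_small (u : R) : 1 <= 112 - u -> cutsize u = Num.min 1 u.
Proof. by move=> h; rewrite /cutsize (min_l h) addrK. Qed.

Local Notation pw a b := (dev (e a) (e b) + stray a b).

Lemma pw_ge0 a b : 0 <= pw a b.
Proof. by rewrite addr_ge0 ?dev_ge0 ?stray_ge0. Qed.

Lemma prod_bool_ge0 (P : pred 'I_8) (p : pred 'I_8) : 0 <= \prod_(c | P c) ((p c)%:R : R).
Proof. exact: prodr_ge0. Qed.

Lemma prod_bool_le1 (P : pred 'I_8) (p : pred 'I_8) : \prod_(c | P c) ((p c)%:R : R) <= 1.
Proof. by apply: prodr_ile1 => c _; case: (p c); rewrite ?lexx ler01. Qed.

Lemma sumB_le8 : \sum_a ((B (e a))%:R : R) <= 8.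
Proof.
apply: (@le_trans _ _ (\sum_(a < 8) 1)); last by rewrite sumr_const card_ord.
by apply: ler_sum => a _; case: (B _).
Qed.

(** From here on [label_count] is evaluated for each class pattern of the tuple; here the products
    with a minus sign are dropped. *)
Lemma label_count_le_B1 : label_count <= \sum_a (B (e a))%:R + 1.
Proof.
have h1 : \sum_a ((B (e a))%:R * \prod_(c | c != a) (~~ X (e c))%:R) <= \sum_a ((B (e a))%:R : R).
  by apply: ler_sum => a _; rewrite ler_piMr // prod_bool_le1.
have h2 := prod_bool_le1 xpredT (fun a => ~~ X (e a)).
have h3 := prod_bool_ge0 xpredT (fun a => B (e a)).
have h4 := prod_bool_ge0 xpredT (fun a => G (e a)).
have h5 : 0 <= \sum_a ((G (e a))%:R * \prod_(c | c != a) (B (e c))%:R) :> R.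
  by rewrite sumr_ge0 // => a _; rewrite mulr_ge0 // prod_bool_ge0.
rewrite /label_count; lra.
Qed.

Lemma label_count_X a : X (e a) -> label_count <= 0.
Proof.
move=> Xa.
have h1 : \sum_a ((B (e a))%:R * \prod_(c | c != a) (~~ X (e c))%:R) = 0 :> R.
  rewrite big1 // => c _; case: (eqVneq c a) => [->|ca].
    by have := BGX (e a); rewrite Xa; case: (B _) => //=; rewrite ?andbF // mul0r.
  by rewrite (bigD1 a) 1?eq_sym //= Xa mul0r mulr0.
have h2 : \prod_a (~~ X (e a))%:R = 0 :> R by rewrite (bigD1 a) //= Xa mul0r.
have h3 := prod_bool_ge0 xpredT (fun a => B (e a)).
have h4 := prod_bool_ge0 xpredT (fun a => G (e a)).
have h5 : 0 <= \sum_a ((G (e a))%:R * \prod_(c | c != a) (B (e c))%:R) :> R.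
  by rewrite sumr_ge0 // => c _; rewrite mulr_ge0 // prod_bool_ge0.
rewrite /label_count h1 h2; lra.
Qed.

Lemma label_count_allG : (forall a, G (e a)) -> label_count <= 0.
Proof.
move=> aG; have nB a : B (e a) = false.
  by have := BGX (e a); rewrite aG; case: (B _).
have h1 : \sum_a ((B (e a))%:R * \prod_(c | c != a) (~~ X (e c))%:R) = 0 :> R.
  by rewrite big1 // => c _; rewrite nB mul0r.
have h2 := prod_bool_le1 xpredT (fun a => ~~ X (e a)).
have h3 := prod_bool_ge0 xpredT (fun a => B (e a)).
have h4 : \prod_a (G (e a))%:R = 1 :> R by rewrite big1 // => c _; rewrite aG.
have h5 : 0 <= \sum_a ((G (e a))%:R * \prod_(c | c != a) (B (e c))%:R) :> R.
  by rewrite sumr_ge0 // => c _; rewrite mulr_ge0 // prod_bool_ge0.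
rewrite /label_count h1 h4; lra.
Qed.

Lemma label_count_oneG a : G (e a) -> (forall c, c != a -> B (e c)) -> label_count <= \sum_a (B (e a))%:R.
Proof.
move=> Ga oB.
have h1 : \sum_a ((B (e a))%:R * \prod_(c | c != a) (~~ X (e c))%:R) <= \sum_a ((B (e a))%:R : R).
  by apply: ler_sum => c _; rewrite ler_piMr // prod_bool_le1.
have h2 := prod_bool_le1 xpredT (fun a => ~~ X (e a)).
have h3 := prod_bool_ge0 xpredT (fun a => B (e a)).
have h4 := prod_bool_ge0 xpredT (fun a => G (e a)).
have h5 : 1 <= \sum_a ((G (e a))%:R * \prod_(c | c != a) (B (e c))%:R) :> R.
  rewrite (bigD1 a) //= Ga mul1r [X in X + _]big1 => [|c /oB -> //].
  by rewrite lerDl sumr_ge0 // => c _; rewrite mulr_ge0 // prod_bool_ge0.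
rewrite /label_count; lra.
Qed.

Lemma label_count_allB : (forall a, B (e a)) -> label_count <= 7.
Proof.
move=> aB; have h0 := sumB_le8.
have h1 : \sum_a ((B (e a))%:R * \prod_(c | c != a) (~~ X (e c))%:R) <= \sum_a ((B (e a))%:R : R).
  by apply: ler_sum => c _; rewrite ler_piMr // prod_bool_le1.
have h2 := prod_bool_le1 xpredT (fun a => ~~ X (e a)).
have h3 : \prod_a (B (e a))%:R = 1 :> R by rewrite big1 // => c _; rewrite aB.
have h4 := prod_bool_ge0 xpredT (fun a => G (e a)).
have h5 : 0 <= \sum_a ((G (e a))%:R * \prod_(c | c != a) (B (e c))%:R) :> R.
  by rewrite sumr_ge0 // => c _; rewrite mulr_ge0 // prod_bool_ge0.
rewrite /label_count h3; lra.
Qed.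

(* At least six pairs through a common position are then misassigned. *)
Lemma label_count_le_dominated l : injective e -> (forall a, ~~ X (e a)) -> (exists a, B (e a)) ->
  112 - load l < 1 -> label_count <= \sum_a \sum_(b | b != a) pw a b.
Proof.
move=> inj nX [a0 Ba0] hl.
have hz a b : a != b -> 3/2 <= z l (e a) (e b) + z l (e b) (e a).
  move=> ab; have := load_ge_pairC l ab; lra.
(* The common position [i] is one of class B with a label other than [l] or, if [l] is the only
   label of class B, any position other than [a0]; then [l] lies in the tuple and what it takes is
   stray. *)
have [i hi] : exists i, forall j, j != i -> e j != l -> 
    z l (e i) (e j) <= pw i j /\ z l (e j) (e i) <= pw j i.
  case: (pickP [pred a | B (e a) && (e a != l)]) => [i /andP[Bi il]|none].
    exists i => j ji jl; have nij : e i != e j by rewrite (inj_eq inj) eq_sym.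
    have nji : e j != e i by rewrite (inj_eq inj).
    have hs := stray_ge0 i j; have hs' := stray_ge0 j i.
    have h3 := z3_le1 (e i) (e j) nij il jl; have h3' := z3_le1 (e j) (e i) nij il jl.
    have h2 := z2_le1 (e i) (e j) il; have h2' := z2_le1 (e j) (e i) il.
    rewrite /dev (negbTE nij) (negbTE nji) Bi /=.
    have := BGX (e j); have := nX j; case: (X _) => // _; case: (B (e j)); case: (G (e j)) => //= _;
    split; lra.
  have el : e a0 = l by have := none a0; rewrite /= Ba0 /=; case: eqP.
  have [i ia0] : exists i : 'I_8, i != a0.
    by exists (if a0 == ord0 then ord_max else ord0); case: (eqVneq a0 ord0) => [->|] //; rewrite eq_sym.
  exists i => j ji jl; have ja0 : j != a0 by apply: contraNneq jl => ->; rewrite el.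
  have hd := dev_ge0 (e i) (e j); have hd' := dev_ge0 (e j) (e i).
  have hs : z l (e i) (e j) <= stray i j.
    by rewrite /stray (bigD1 a0) /= ?el ?lerDl ?sumr_ge0 // eq_sym ia0 eq_sym ja0.
  have hs' : z l (e j) (e i) <= stray j i.
    by rewrite /stray (bigD1 a0) /= ?el ?lerDl ?sumr_ge0 // eq_sym ja0 eq_sym ia0.
  split; lra.
apply: (@le_trans _ _ (\sum_(j | j != i) (pw i j + pw j i))); last first.
  exact: (sum_star (p := fun a b => pw a b) i pw_ge0).
apply: (@le_trans _ _ (\sum_(j | (j != i) && (e j != l)) (3/2 : R))); last first.
  rewrite [leRHS](bigID (fun j => e j != l)) /= -[leLHS]addr0 lerD //; last first.
    by rewrite sumr_ge0 // => j _; rewrite addr_ge0 ?pw_ge0.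
  apply: ler_sum => j /andP[ji jl]; have [h1 h2] := hi _ ji jl.
  have ij : i != j by rewrite eq_sym.
  have := hz _ _ ij; lra.
(* Of the eight positions only [i] and the one labelled [l], if any, are lost; 6 * 3/2 = 9 is the
   general bound on [label_count]. *)
have c6 : (6 <= #|[pred j : 'I_8 | (j != i) && (e j != l)]|)%N.
  have c1 : (#|[pred j : 'I_8 | e j == l]| <= 1)%N.
    apply/card_le1P => u; rewrite inE => /eqP hu v; rewrite !inE.
    by apply/eqP/eqP => [hv|->//]; apply: inj; rewrite hu hv.
  have := cardC [pred j : 'I_8 | (j != i) && (e j != l)]; rewrite card_ord => h8.
  have : (#|[predC [pred j : 'I_8 | (j != i) && (e j != l)]]| <= 2)%N.
    apply: (@leq_trans (#|pred1 i| + #|[pred j : 'I_8 | e j == l]|)).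
      rewrite -cardUI; apply: leq_trans (leq_addr _ _).
      by apply: subset_leq_card; apply/subsetP => j; rewrite !inE negb_and !negbK.
    by rewrite card1 addSn add0n ltnS.
  move: h8; set u := #|_|; set v := #|_|; move=> h8 h2.
  by rewrite -(leq_add2r v) -[leqRHS]/(u + v)%N h8 -[8%N]/(6 + 2)%N leq_add2l.
have hB := label_count_le_B1; have h8 := sumB_le8.
rewrite sumr_const -mulr_natl.
have : 6 <= #|[pred j : 'I_8 | (j != i) && (e j != l)]|%:R :> R by rewrite ler_nat.
lra.
Qed.

(** If the cut does not pay a full unit for [e a], this label took less than 1/2 of the total 2 from
    its block with [e b], and the rest counts as deviation. *)
Lemma min1_dev_B a b : injective e -> a != b -> B (e a) -> G (e b) ->
  1 <= Num.min 1 (load (e a)) + (pw a b + pw b a).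
Proof.
move=> inj ab Ba Gb; have nab : e a != e b by rewrite (inj_eq inj).
have nBb : B (e b) = false by have := BGX (e b); rewrite Gb; case: (B _).
have h := load_ge_pair (e a) ab.
have hs := stray_ge0 a b; have hs' := stray_ge0 b a.
have h1 := z_le1 (e a) (e a) (e b); have h2 := z_le1 (e a) (e b) (e a).
have z1 := z_ge0 (e a) (e a) (e b); have z2 := z_ge0 (e a) (e b) (e a).
rewrite /dev (negbTE nab) eq_sym (negbTE nab) Ba nBb Gb /=.
by case: (leP 1 (load (e a))) => hl; lra.
Qed.

(** With both loads below 1, each label takes less than 1/2 from a block of total 2, so more than 1
    deviates; the factor 2 in [load] enters here. *)
Lemma min1_dev_BB a b : injective e -> a != b -> B (e a) -> B (e b) ->
  load (e b) <= load (e a) -> 1 <= Num.min 1 (load (e a)) + (pw a b + pw b a).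
Proof.
move=> inj ab Ba Bb ba; have nab : e a != e b by rewrite (inj_eq inj).
have h := load_ge_pair (e a) ab; have h' := load_ge_pair (e b) ab.
have hs := pw_ge0 a b; have hs' := pw_ge0 b a.
case: (leP 1 (load (e a))) => hl; first lra.
have st := stray_ge0 a b; have st' := stray_ge0 b a.
rewrite /dev (negbTE nab) eq_sym (negbTE nab) Ba Bb /=.
have z1 := z_ge0 (e a) (e a) (e b); have z2 := z_ge0 (e a) (e b) (e a).
have z3 := z_ge0 (e b) (e a) (e b); have z4 := z_ge0 (e b) (e b) (e a).
lra.
Qed.

Lemma sum_min1 (P : pred 'I_k) : 
  Num.min 1 (\sum_(l | P l) load l) <= \sum_(l | P l) Num.min 1 (load l).
Proof.
have := sum_min_ge P ler01 load_ge0; rewrite minC => /le_trans; apply.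
by apply: ler_sum => l _; rewrite minC.
Qed.

Local Notation own := [seq e a | a <- enum 'I_8 & B (e a)].

Lemma sum_own (F : 'I_k -> R) : injective e ->
  \sum_(l | l \in own) F l = \sum_(a | B (e a)) F (e a).
Proof.
move=> inj; rewrite -(@big_uniq _ _ _ _ own); last first.
  by rewrite map_inj_uniq // filter_uniq // enum_uniq.
by rewrite big_map big_filter big_enum_cond.
Qed.

Lemma sum_min1_split : injective e ->
  \sum_l Num.min 1 (load l) = \sum_(a | B (e a)) Num.min 1 (load (e a))
    + \sum_(l | l \notin own) Num.min 1 (load l).
Proof.
by move=> inj; rewrite (bigID (mem own)) /= sum_own.
Qed.

(** Each label of class B is charged to its own truncated load and to its pair with one pivot
    position, so no pair is charged twice. The pivot is the position of least load if all are of
    class B, and a position of class G otherwise. *)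
Lemma label_count_le_undominated : injective e -> (forall a, ~~ X (e a)) -> (exists a, B (e a)) ->
  (forall l, 1 <= 112 - load l) ->
  label_count <= \sum_l cutsize (load l) + \sum_a \sum_(b | b != a) pw a b.
Proof.
move=> inj nX [a0 Ba0] hl.
have notB a : ~~ B (e a) -> G (e a).
  by have := BGX (e a); have := nX a; case: (X _) => // _; case: (B _); case: (G _).
have -> : \sum_l cutsize (load l) = \sum_l Num.min 1 (load l).
  by apply: eq_bigr => l _; rewrite cutsize_small.
have pmin l : 0 <= Num.min 1 (load l) by rewrite le_min ler01 load_ge0.
have star c : \sum_(j | j != c) (pw c j + pw j c) <= \sum_a \sum_(b | b != a) pw a b.
  exact: (sum_star (p := fun a b => pw a b) c pw_ge0).
have star0 c j : 0 <= pw c j + pw j c by rewrite addr_ge0 ?pw_ge0.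
rewrite sum_min1_split //.
set rest := (X in _ <= _ + X + _).
have rest0 : 0 <= rest by rewrite sumr_ge0.
have sumB : \sum_a (B (e a))%:R = \sum_(a | B (e a)) 1 :> R.
  by rewrite [RHS]big_mkcond /=; apply: eq_bigr => a _; case: (B _).
case: (pickP [pred a | ~~ B (e a)]) => [g nBg|allB]; last first.
  have {}allB a : B (e a) by have := allB a; rewrite /= => /negbFE.
  have [c hc] : exists c, forall a, load (e c) <= load (e a).
    case: (@Order.TotalTheory.arg_minP _ _ _ ord0 xpredT (fun a => load (e a)) isT) => c _ hc.
    by exists c => a; apply: hc.
  have : \sum_(a | a != c) (1 : R) <= \sum_(a | a != c) (Num.min 1 (load (e a)) + (pw c a + pw a c)).
    apply: ler_sum => a ac; have := min1_dev_BB inj ac (allB a) (allB c) (hc a); lra.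
  rewrite sumr_const cardC1 card_ord big_split /= => h.
  have h2 : \sum_(a | a != c) Num.min 1 (load (e a)) <= \sum_(a | B (e a)) Num.min 1 (load (e a)).
    rewrite [leRHS](bigD1 c) //= -[leLHS]add0r lerD // le_eqVlt; apply/orP; left; apply/eqP.
    by apply: eq_bigl => a; rewrite allB.
  have := star c; have := label_count_allB allB; lra.
have Gg := notB _ nBg.
have hsB : \sum_a (B (e a))%:R <= \sum_(a | B (e a)) Num.min 1 (load (e a)) + \sum_(a | B (e a)) (pw g a + pw a g).
  rewrite sumB -big_split /=; apply: ler_sum => a Ba.
  have ag : a != g by apply: contraNneq nBg => <-.
  have := min1_dev_B inj ag Ba Gg; lra.
have hB : \sum_(a | B (e a)) (pw g a + pw a g) <= \sum_(j | j != g) (pw g j + pw j g).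
  rewrite [leRHS](bigID (fun a => B (e a))) /= -[leLHS]addr0 lerD ?sumr_ge0 //.
  rewrite le_eqVlt; apply/orP; left; apply/eqP; apply: eq_bigl => a.
  by case: (eqVneq a g) => [->|]; rewrite ?andbT //= (negbTE nBg).
case: (pickP [pred a | ~~ B (e a) && (a != g)]) => [h /= /andP[nBh hg]|none]; last first.
  have oneG c : c != g -> B (e c).
    by move=> cg; have := none c; rewrite /= cg andbT => /negbFE.
  have := label_count_oneG Gg oneG; have := star g; lra.
have hB2 : \sum_(a | B (e a)) (pw g a + pw a g) + (pw g h + pw h g) <= \sum_(j | j != g) (pw g j + pw j g).
  rewrite [leRHS](bigID (fun a => B (e a))) /= lerD //.
    rewrite le_eqVlt; apply/orP; left; apply/eqP; apply: eq_bigl => a.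
    by case: (eqVneq a g) => [->|]; rewrite ?andbT //= (negbTE nBg).
  by rewrite (bigD1 h) ?hg //= lerDl sumr_ge0.
(* The unit for a second position of class G: what the B labels of the tuple take from the block of
   [g] and [h] is stray, and what other labels take is load outside [own]. *)
have hr : 1 <= rest + (pw g h + pw h g).
  have gh : g != h by rewrite eq_sym.
  apply: (@le_trans _ _ (Num.min 1 (\sum_(l | l \notin own) load l) + (stray g h + stray h g))); last first.
    have := sum_min1 (fun l => l \notin own).
    have := dev_ge0 (e g) (e h); have := dev_ge0 (e h) (e g); rewrite -/rest; lra.
  have tot u v : 1 <= \sum_(l | l \notin own) z l (e u) (e v) + \sum_(a | B (e a)) z (e a) (e u) (e v).
    by rewrite -(z_sum (e u) (e v)) (bigID (mem own)) /= sum_own // addrC.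
  have hst u v : ~~ B (e u) -> ~~ B (e v) -> \sum_(a | B (e a)) z (e a) (e u) (e v) <= stray u v.
    move=> nu nv; rewrite /stray [leRHS](bigID (fun a => B (e a))) /= -[leLHS]addr0 lerD ?sumr_ge0 //.
    rewrite le_eqVlt; apply/orP; left; apply/eqP; apply: eq_bigl => a.
    by case: (boolP (B (e a))) => Ba; rewrite ?andbF // andbT; 
      apply/esym/andP; split; [apply: contraNneq nu => <-|apply: contraNneq nv => <-].
  have hload : 2 * (\sum_(l | l \notin own) z l (e g) (e h) +
      \sum_(l | l \notin own) z l (e h) (e g)) <=
      \sum_(l | l \notin own) load l.
    rewrite -big_split /= mulr_sumr; apply: ler_sum => l _; exact: load_ge_pair.
  have t1 := tot g h; have t2 := tot h g.
  have s1 := hst _ _ nBg nBh; have s2 := hst _ _ nBh nBg.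
  have p1 : 0 <= \sum_(l | l \notin own) z l (e g) (e h) by rewrite sumr_ge0.
  have p2 : 0 <= \sum_(l | l \notin own) z l (e h) (e g) by rewrite sumr_ge0.
  have q1 := stray_ge0 g h; have q2 := stray_ge0 h g.
  move: t1 t2 s1 s2 p1 p2 hload; set s := \sum_(l | _) load l => t1 t2 s1 s2 p1 p2 hload.
  case: (leP 1 s) => hs; lra.
have := star g; have := label_count_le_B1; lra.
Qed.

Lemma collide_ge0 : 0 <= collide.
Proof. by rewrite sumr_ge0 // => a _; rewrite sumr_ge0. Qed.

(* The error terms are [collide] for repeated labels in the tuple and [stray]
   for a pair of G labels assigned to a third label of the clique.  Both are
   O(1/k) on average over tuples. *)
Lemma label_count_le : label_count <= 9 * collide +
  (\sum_l cutsize (load l) + \sum_a \sum_(b | b != a) pw a b).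
Proof.
have c0 := collide_ge0.
have d0 : 0 <= \sum_a \sum_(b | b != a) pw a b.
  by rewrite sumr_ge0 // => a _; rewrite sumr_ge0 // => b _; apply: pw_ge0.
have k0 : 0 <= \sum_l cutsize (load l).
  by rewrite sumr_ge0 // => l _; rewrite cutsize_ge0 // load_ge0 load_le.
case: (pickP [pred a | X (e a)]) => [a /= /label_count_X|nX]; first lra.
have {}nX a : ~~ X (e a) by rewrite [X _](nX a).
case: (pickP [pred a | B (e a)]) => [a /= Ba|nB]; last first.
  have : label_count <= 0.
    apply: label_count_allG => a; have := BGX (e a); have := nX a; have := nB a; rewrite /= => ->.
    by case: (X _); case: (G _).
  lra.
case: (boolP (injectiveb e)) => [/injectiveP inj|/injectivePn[u [v uv euv]]]; last first.
  (* [label_count] is at most 8 + 1, hence the factor 9. *)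
  have : 1 <= collide.
    rewrite /collide (bigD1 u) //= (bigD1 v) 1?eq_sym //= euv eqxx -addrA lerDl.
    by rewrite addr_ge0 ?sumr_ge0 // => c _; rewrite sumr_ge0.
  have := label_count_le_B1; have := sumB_le8; lra.
have exB : exists a, B (e a) by exists a.
case: (pickP [pred l | 112 - load l < 1]) => [l /= hl|hl].
  have := label_count_le_dominated inj nX exB hl; lra.
have {}hl l : 1 <= 112 - load l by have := hl l; rewrite /= ltNge => /negbFE.
have := label_count_le_undominated inj nX exB hl; lra.
Qed.

End Tuple.

(** * Lower bound for fractional assignments *)

Section Row.
Variable R : realFieldType.
Local Notation beta := (star_weight R).

(* [y] ranges over [0, 2]: it adds the fractions of (i, j, _) and of (j, i, _). *)
Definition tent (y : R) : R := Num.min (beta * y) (2 * (1 + beta) - beta * y).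

Lemma tentl y : beta * y <= 1 + beta -> tent y = beta * y.
Proof. by move=> h; rewrite /tent min_l //; lra. Qed.

Lemma tentr y : 1 + beta <= beta * y -> tent y = 2 * (1 + beta) - beta * y.
Proof. by move=> h; rewrite /tent min_r //; lra. Qed.

Variables (k : nat) (y : 'I_k -> R) (i : 'I_k).
Hypothesis y_ge0 : forall l, 0 <= y l.
Hypothesis y_sum : \sum_l y l = 2.

(** Part [i] contains the terminal of the star, so its tent is read on the complement. *)
Definition row_cost : R := \sum_l (if l == i then tent (2 - y l) else tent (y l)).

Lemma row_costE : row_cost = tent (2 - y i) + \sum_(l | l != i) tent (y l).
Proof.
rewrite /row_cost (bigD1 i) //= eqxx; congr (_ + _).
by apply: eq_bigr => l /negbTE ->.
Qed.

Lemma sum_others : \sum_(l | l != i) y l = 2 - y i.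
Proof. by rewrite -y_sum [in RHS](bigD1 i) //=; lra. Qed.

Lemma y_le_others l : l != i -> y l <= 2 - y i.
Proof. by move=> li; rewrite -sum_others (bigD1 l) //= lerDl sumr_ge0. Qed.

(** The class determines on which side of its peak each tent is read, so the cost is linear in [y];
    classes G and X below work the same way. *)
Lemma row_cost_B : beta * (2 - y i) <= 1 + beta -> row_cost = 2 * beta * (2 - y i).
Proof.
move=> h; rewrite row_costE tentl //.
under eq_bigr => l li.
  rewrite tentl; last by have := y_le_others li; move: h; rewrite /star_weight; lra.
  over.
rewrite -mulr_sumr sum_others; ring.
Qed.

Lemma row_cost_G : 1 + beta < beta * (2 - y i) ->
  (forall l, l != i -> beta * y l <= 1 + beta) -> row_cost = 2 * (1 + beta).
Proof.
move=> h hl; rewrite row_costE tentr ?ltW //.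
under eq_bigr => l li do rewrite tentl ?hl //.
rewrite -mulr_sumr sum_others; ring.
Qed.

(** (1 + beta) / beta exceeds 1, half of the total, so there is no second heavy label and [y i] is
    small. *)
Lemma row_cost_X b : b != i -> 1 + beta < beta * y b ->
  row_cost = 4 * (1 + beta) - 2 * beta * y b.
Proof.
move=> bi h; rewrite row_costE tentr; last first.
  by have := y_le_others bi; move: h; rewrite /star_weight; lra.
rewrite (bigD1 b) //= tentr ?ltW //.
have hs : \sum_(l | (l != i) && (l != b)) y l = 2 - y i - y b.
  by rewrite -sum_others [in RHS](bigD1 b) //=; lra.
under eq_bigr => l /andP[li lb].
  rewrite tentl; last first.
    have : y l <= 2 - y i - y b by rewrite -hs (bigD1 l) ?li //= lerDl sumr_ge0.
    by have := y_ge0 i; move: h; rewrite /star_weight; lra.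
  over.
rewrite -mulr_sumr hs; ring.
Qed.

End Row.

(** * Averages over all 8-tuples of labels *)

Section Average.
Variables (R : realFieldType) (k : nat).
Notation tuple8 := {ffun 'I_8 -> 'I_k}.

Lemma sum_tuple_prod (F : 'I_8 -> 'I_k -> R) :
  \sum_(e : tuple8) \prod_c F c (e c) = \prod_c \sum_u F c u.
Proof. by rewrite bigA_distr_bigA. Qed.

(** Indicators of the values at [a], [b], [c] turn the summand into products over positions, to
    which [sum_tuple_prod] applies; the five other positions are free. *)
Lemma sum_tuple3 (p : 'I_k -> 'I_k -> 'I_k -> R) a b c : a != b -> c != a -> c != b ->
  \sum_(e : tuple8) p (e c) (e a) (e b) = k%:R ^+ 5 * \sum_l \sum_i \sum_j p l i j.
Proof.
move=> ab ca cb.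
have ac : a != c by rewrite eq_sym.
have bc : b != c by rewrite eq_sym.
have ba : b != a by rewrite eq_sym.
pose F l i j (c' : 'I_8) (u : 'I_k) : R :=
  if c' == c then (u == l)%:R else if c' == a then (u == i)%:R else if c' == b then (u == j)%:R else 1.
have Fc l i j u : F l i j c u = (u == l)%:R by rewrite /F eqxx.
have Fa l i j u : F l i j a u = (u == i)%:R by rewrite /F [a == c]eq_sym (negbTE ca) eqxx.
have Fb l i j u : F l i j b u = (u == j)%:R.
  by rewrite /F [b == c]eq_sym (negbTE cb) [b == a]eq_sym (negbTE ab) eqxx.
have Fd l i j d u : (d != c) && (d != a) && (d != b) -> F l i j d u = 1.
  by move=> /andP[/andP[/negbTE dc /negbTE da] /negbTE db]; rewrite /F dc da db.
have FE l i j (e : tuple8) : \prod_c' F l i j c' (e c') = (e c == l)%:R * (e a == i)%:R * (e b == j)%:R.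
  rewrite (bigD1 c) // (bigD1 a) //= (bigD1 b) /= ?bc //.
  by rewrite Fc Fa Fb big1 ?mulr1 ?mulrA // => d /Fd.
have S1 (i : 'I_k) : \sum_u (u == i)%:R = 1 :> R.
  by rewrite (bigD1 i) //= eqxx big1 ?addr0 // => u /negbTE ->.
have SF l i j : \sum_(e : tuple8) \prod_c' F l i j c' (e c') = k%:R ^+ 5.
  rewrite sum_tuple_prod (bigD1 c) // (bigD1 a) //= (bigD1 b) /= ?bc //.
  rewrite (eq_bigr _ (fun u _ => Fc l i j u)) (eq_bigr _ (fun u _ => Fa l i j u)) (eq_bigr _ (fun u _ => Fb l i j u)).
  rewrite !S1 !mul1r (eq_bigr (fun=> k%:R)) => [|d /Fd hd]; last first.
    by rewrite (eq_bigr (fun=> 1)) ?sumr_const ?card_ord.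
  rewrite prodr_const; congr (_ ^+ _).
  have := cardC [pred d | [&& d != c, d != a & d != b]]; rewrite card_ord.
  have -> : #|[predC [pred d | [&& d != c, d != a & d != b]]]| = 3%N.
    rewrite (@eq_card _ _ (mem [:: c; a; b])); first by rewrite (card_uniqP _) //= !inE negb_or ca cb ab.
    by move=> d; rewrite !inE !negb_and !negbK.
  move=> h; apply: (@addIn 3%N); apply: etrans h; congr (_ + _)%N; apply: eq_card => d.
  by rewrite !inE andbA.
have -> : \sum_(e : tuple8) p (e c) (e a) (e b) =
    \sum_(e : tuple8) \sum_l \sum_i \sum_j p l i j * \prod_c' F l i j c' (e c').
  apply: eq_bigr => e _.
  rewrite (bigD1 (e c)) //= [X in _ + X]big1 => [|l hl]; last first.
    by rewrite big1 // => i _; rewrite big1 // => j _; rewrite FE eq_sym (negbTE hl) !mul0r mulr0.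
  rewrite addr0 (bigD1 (e a)) //= [X in _ + X]big1 => [|i hi]; last first.
    by rewrite big1 // => j _; rewrite FE [_ == i]eq_sym (negbTE hi) mulr0 !mul0r mulr0.
  rewrite addr0 (bigD1 (e b)) //= [X in _ + X]big1 => [|j hj]; last first.
    by rewrite FE [_ == j]eq_sym (negbTE hj) mulr0 mulr0.
  by rewrite FE !eqxx !mulr1 addr0.
rewrite exchange_big mulr_sumr; apply: eq_bigr => l _.
rewrite exchange_big mulr_sumr; apply: eq_bigr => i _.
rewrite exchange_big mulr_sumr; apply: eq_bigr => j _.
by rewrite -mulr_sumr SF mulrC.
Qed.

Lemma sum_tuple2 (p : 'I_k -> 'I_k -> R) a b : a != b ->
  \sum_(e : tuple8) p (e a) (e b) = k%:R ^+ 6 * \sum_i \sum_j p i j.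
Proof.
move=> ab.
have [c /andP[ca cb]] : exists c : 'I_8, (c != a) && (c != b).
  case: (pickP [pred c | (c != a) && (c != b)]) => [c hc|none]; first by exists c.
  have : (#|'I_8| <= size [:: a; b])%N.
    apply: leq_trans (card_size _); apply: subset_leq_card; apply/subsetP => c _.
    by have := none c; rewrite /= !inE => /negbT; rewrite negb_and !negbK.
  by rewrite card_ord.
rewrite (sum_tuple3 (fun _ => p) ab ca cb) sumr_const card_ord -mulr_natl; ring.
Qed.

Lemma sum_tuple_pairs (p : 'I_k -> 'I_k -> R) :
  \sum_(e : tuple8) \sum_a \sum_(b | b != a) p (e a) (e b) = 56 * k%:R ^+ 6 * \sum_i \sum_j p i j.
Proof.
rewrite exchange_big /=; under eq_bigr => a _ do rewrite exchange_big /=.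
rewrite (eq_bigr (fun a : 'I_8 => \sum_(b < 8 | b != a) (k%:R ^+ 6 * \sum_i \sum_j p i j))).
  by rewrite sum_pairs_const mulrA.
by move=> a _; apply: eq_bigr => b ba; rewrite sum_tuple2 // eq_sym.
Qed.

Lemma card_others (a b : 'I_8) : a != b -> #|[pred c | (c != a) && (c != b)]| = 6%N.
Proof.
move=> ab; have := cardC [pred c | (c != a) && (c != b)]; rewrite card_ord.
have -> : #|[predC [pred c | (c != a) && (c != b)]]| = 2%N.
  rewrite (@eq_card _ _ (mem [:: a; b])); first by rewrite (card_uniqP _) //= !inE ab.
  by move=> d; rewrite !inE !negb_and !negbK.
by move=> h; apply: (@addIn 2%N); apply: h.
Qed.

(** 56 ordered pairs, 6 third positions and k^7 for each: one order below the k^8 tuples. *)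
Lemma sum_tuple_stray (z : 'I_k -> 'I_k -> 'I_k -> R) : (forall i j, \sum_l z l i j = 1) ->
  \sum_(e : tuple8) \sum_a \sum_(b | b != a) stray z e a b = 336 * k%:R ^+ 7.
Proof.
move=> z1.
have S : \sum_l \sum_i \sum_j z l i j = k%:R ^+ 2.
  rewrite exchange_big /=; under eq_bigr => i _ do rewrite exchange_big /=.
  under eq_bigr => i _ do under eq_bigr => j _ do rewrite z1.
  by under eq_bigr do rewrite sumr_const; rewrite sumr_const card_ord -mulr_natl; ring.
rewrite exchange_big /=; under eq_bigr => a _ do rewrite exchange_big /=.
rewrite (eq_bigr (fun a : 'I_8 => \sum_(b < 8 | b != a) (6 * (k%:R ^+ 7)))).
  rewrite sum_pairs_const; ring.
move=> a _; apply: eq_bigr => b ba; rewrite /stray exchange_big /=.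
rewrite (eq_bigr (fun=> k%:R ^+ 7)) => [|c /andP[ca cb]].
  by rewrite sumr_const card_others 1?eq_sym // mulr_natl.
by rewrite (sum_tuple3 z _ ca cb) 1?eq_sym // S; ring.
Qed.

Lemma sum_tuple_collide : \sum_(e : tuple8) collide R e = 56 * k%:R ^+ 7.
Proof.
rewrite /collide (sum_tuple_pairs (fun i j => (i == j)%:R)).
rewrite (eq_bigr (fun=> 1)) => [|i _]; last first.
  by rewrite (bigD1 i) //= eqxx big1 ?addr0 // => j /negbTE; rewrite eq_sym => ->.
by rewrite sumr_const card_ord; ring.
Qed.

Lemma sum_tuple_indic (p : 'I_k -> R) : \sum_(e : tuple8) \prod_a p (e a) = (\sum_i p i) ^+ 8.
Proof. by rewrite (sum_tuple_prod (fun=> p)) prodr_const card_ord. Qed.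

Lemma sum_tuple_indic1 (p q : 'I_k -> R) :
  \sum_(e : tuple8) \sum_a (p (e a) * \prod_(c | c != a) q (e c)) =
  8 * ((\sum_i p i) * (\sum_i q i) ^+ 7).
Proof.
rewrite exchange_big /= (eq_bigr (fun=> (\sum_i p i) * (\sum_i q i) ^+ 7)).
  by rewrite sumr_const card_ord mulr_natl.
move=> a _; pose F (c : 'I_8) := if c == a then p else q.
have FE (e : tuple8) : p (e a) * \prod_(c | c != a) q (e c) = \prod_c F c (e c).
  rewrite [RHS](bigD1 a) //= /F eqxx; congr (_ * _).
  by apply: eq_bigr => c /negbTE ->.
under eq_bigr => e _ do rewrite FE.
rewrite sum_tuple_prod (bigD1 a) //= /F eqxx; congr (_ * _).
rewrite (eq_bigr (fun=> \sum_i q i)) => [|c /negbTE -> //].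
by rewrite prodr_const cardC1 card_ord.
Qed.

Lemma sum_tuple_label_count (B G X : pred 'I_k) :
  \sum_(e : tuple8) label_count R B G X e =
  8 * ((\sum_i (B i)%:R) * (\sum_i (~~ X i)%:R) ^+ 7) + (\sum_i (~~ X i)%:R) ^+ 8
  - 2 * (\sum_i (B i)%:R) ^+ 8 - 8 * ((\sum_i (G i)%:R) * (\sum_i (B i)%:R) ^+ 7)
  - (\sum_i (G i)%:R) ^+ 8.
Proof.
have EX : \sum_(e : tuple8) \prod_a (~~ X (e a))%:R = _ := sum_tuple_indic (fun i => (~~ X i)%:R).
have EB : \sum_(e : tuple8) \prod_a (B (e a))%:R = _ := sum_tuple_indic (fun i => (B i)%:R).
have EG : \sum_(e : tuple8) \prod_a (G (e a))%:R = _ := sum_tuple_indic (fun i => (G i)%:R).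
have EBX := sum_tuple_indic1 (fun i => (B i)%:R) (fun i => (~~ X i)%:R).
have EGB := sum_tuple_indic1 (fun i => (G i)%:R) (fun i => (B i)%:R).
by rewrite /label_count !big_split /= !sumrN -mulr_sumr EX EB EG EBX EGB.
Qed.

End Average.

(** * Combining stars and cliques *)

Section LowerBound.
Variables (R : realFieldType) (k : nat).
Local Notation beta := (star_weight R).

(** The public function in terms of the terminals and densities of a set. A total clique weight k /
    16 is spread over the k^8 tuples; in the planted version eight half units per tuple then cost
    1/4 per label. *)
Definition profile_val (tau : 'I_k -> bool) (d : 'I_k -> 'I_k -> R) : R :=
  \sum_i (if tau i then tent (2 - (\sum_j (d i j + d j i)) / k%:R) else tent ((\sum_j (d i j + d j i)) / k%:R))
  + k%:R / 16 / k%:R ^+ 8 *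
    \sum_(e : {ffun 'I_8 -> 'I_k}) cutsize (2 * \sum_a \sum_(b | b != a) d (e a) (e b)).

Hypothesis k_gt0 : (0 < k)%N.
Variable z : 'I_k -> 'I_k -> 'I_k -> R.
Hypothesis z_ge0 : forall l i j, 0 <= z l i j.
Hypothesis z_sum : forall i j, \sum_l z l i j = 1.

Let K : R := k%:R.
Let K_gt0 : 0 < K. Proof. by rewrite ltr0n. Qed.

Let y l i : R := (\sum_j (z l i j + z l j i)) / K.

Let y_ge0 l i : 0 <= y l i.
Proof. by rewrite divr_ge0 ?(ltW K_gt0) // sumr_ge0 // => j _; rewrite addr_ge0. Qed.

Let y_sum i : \sum_l y l i = 2.
Proof.
rewrite -mulr_suml exchange_big /=.
rewrite (eq_bigr (fun=> 2)) => [|j _]; last by rewrite big_split /= !z_sum.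
by rewrite sumr_const card_ord -[2 *+ k]mulr_natr mulfK ?gt_eqF.
Qed.

(** [B] and [heavy] compare the argument of a tent with its peak (1 + beta) / beta. *)
Let B i := beta * (2 - y i i) <= 1 + beta.
Let heavy i := [pick l | (l != i) && (1 + beta < beta * y l i)].
Let X i := ~~ B i && (heavy i != None).
Let G i := ~~ B i && (heavy i == None).
Let big i := odflt i (heavy i).

Let BGX i : [|| [&& B i, ~~ G i & ~~ X i], [&& ~~ B i, G i & ~~ X i] | [&& ~~ B i, ~~ G i & X i]].
Proof. by rewrite /G /X; case: (B i); case: (heavy i). Qed.

(* The cost of star i is [base i] plus the average of [slope i], see
   [row_cost_linear]. *)
Let base i : R := if B i then 0 else if X i then 4 * (1 + beta) else 2 * (1 + beta).
Let slope i u v : R := if B i then 2 * beta * (1 - z i u v) else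
  if X i then - (2 * beta * z (big i) u v) else 0.

Lemma row_cost_linear i : row_cost (y ^~ i) i = base i + (\sum_j (slope i i j + slope i j i)) / K.
Proof.
have Kn0 : K != 0 by rewrite gt_eqF.
rewrite /base /slope; case: ifP => [Bi|nBi].
  rewrite row_cost_B // add0r /y -/K.
  have -> : \sum_j (2 * beta * (1 - z i i j) + 2 * beta * (1 - z i j i)) =
      2 * beta * (2 * K - \sum_j (z i i j + z i j i)).
    have -> : 2 * K = \sum_(j < k) 2 by rewrite sumr_const card_ord -[2 *+ k]mulr_natr.
    by rewrite -sumrB mulr_sumr; apply: eq_bigr => j _; ring.
  by field.
case: ifP => [Xi|nXi]; last first.
  rewrite row_cost_G //.
  - by rewrite big1 ?mul0r ?addr0 // => j _; rewrite addr0.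
  - by rewrite ltNge; apply/negP; rewrite -/(B i) nBi.
  move=> l li; rewrite leNgt; apply/negP => hl.
  move: nXi; rewrite /X nBi /= /heavy; case: pickP => [//|/(_ l)].
  by rewrite li hl.
move: (Xi); rewrite /X nBi /= /big /heavy; case: pickP => [l /andP[li hl] _|//].
rewrite (row_cost_X _ _ li hl) //= /y -/K; congr (_ + _).
under [in RHS]eq_bigr do rewrite -opprD -mulrDr.
by rewrite sumrN -mulr_sumr mulNr mulrA.
Qed.

Let b i : R := (B i)%:R.
Let g i : R := (G i)%:R.
Let x i : R := (X i)%:R.
(** [low] bounds the joint cost of the elements (i, j, _) in the stars of i and j: two B labels
    compete for them, an X label wants them for its heavy label. [exc] pays for the diagonal and for
    pairs where one label is heavy for the other; it sums to O(k). *)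
Let low i j : R := 2 * beta * (b i * b j) - 2 * beta * (g i * x j + x i * g j) - 4 * beta * (x i * x j).
Let exc i j : R := (i == j)%:R + (X i && (big i == j))%:R + (X j && (big j == i))%:R.

Lemma pair_bound i j :
  low i j + 2 * beta * dev z B G i j - 2 * beta * exc i j <= slope i i j + slope j i j.
Proof.
have beta0 : 0 < beta by rewrite /star_weight; lra.
suff : b i * b j - (g i * x j + x i * g j) - 2 * (x i * x j) + dev z B G i j - exc i j <=
  (if B i then 1 - z i i j else if X i then - z (big i) i j else 0) +
  (if B j then 1 - z j i j else if X j then - z (big j) i j else 0).
  rewrite -(ler_pM2l (mulr_gt0 (ltr0Sn R 1) beta0)) /low /slope => h.
  have -> : (if B i then 2 * beta * (1 - z i i j) else if X i then - (2 * beta * z (big i) i j) else 0)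
    = 2 * beta * (if B i then 1 - z i i j else if X i then - z (big i) i j else 0).
    by case: (B i); case: (X i); ring.
  have -> : (if B j then 2 * beta * (1 - z j i j) else if X j then - (2 * beta * z (big j) i j) else 0)
    = 2 * beta * (if B j then 1 - z j i j else if X j then - z (big j) i j else 0).
    by case: (B j); case: (X j); ring.
  lra.
have zi := z_le1 z_ge0 z_sum i i j; have zj := z_le1 z_ge0 z_sum j i j.
have bi := z_le1 z_ge0 z_sum (big i) i j; have bj := z_le1 z_ge0 z_sum (big j) i j.
have zi0 := z_ge0 i i j; have zj0 := z_ge0 j i j.
have bi0 := z_ge0 (big i) i j; have bj0 := z_ge0 (big j) i j.
have zz l m : (l == m) || (z l i j + z m i j <= 1).
  by case: eqVneq => //= lm; apply: z2_le1.
have z1 := zz i j; have z2 := zz (big i) j; have z3 := zz (big j) i.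
rewrite /b /g /x /exc /dev; have := BGX i; have := BGX j.
move: z1 z2 z3; case: (i == j) => /= z1 z2 z3; move: z1 z2 z3;
case: (big i == j) => /= z1 z2; case: (big j == i) => /= z3;
case: (B i); case: (X i); case: (G i); case: (B j); case: (X j); case: (G j) => //= _ _; lra.
Qed.

Let s : R := (\sum_i b i) / K.
Let v : R := (\sum_i g i) / K.
Let w : R := (\sum_i x i) / K.

Let Kn0 : K != 0. Proof. by rewrite gt_eqF. Qed.

Let types_sum : s + v + w = 1.
Proof.
rewrite /s /v /w -!mulrDl -!big_split /= (eq_bigr (fun=> 1)) => [|i _].
  by rewrite sumr_const card_ord divff.
by have := BGX i; rewrite /b /g /x; case: (B i); case: (G i); case: (X i) => //= _; ring.
Qed.

Let sum_base : \sum_i base i = K * (2 * (1 + beta) * v + 4 * (1 + beta) * w).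
Proof.
have -> : K * (2 * (1 + beta) * v + 4 * (1 + beta) * w) =
   \sum_i (2 * (1 + beta) * g i + 4 * (1 + beta) * x i).
  by rewrite big_split /= -!mulr_sumr /v /w; field.
apply: eq_bigr => i _; have := BGX i; rewrite /base /g /x.
by case: (B i); case: (G i); case: (X i) => //= _; ring.
Qed.

Let sum_low : \sum_i \sum_j low i j =
  K ^+ 2 * (2 * beta * s ^+ 2 - 4 * beta * (v * w) - 4 * beta * w ^+ 2).
Proof.
have dbl (p q : 'I_k -> R) : \sum_i \sum_j p i * q j = (\sum_i p i) * (\sum_i q i).
  by rewrite mulr_suml; apply: eq_bigr => i _; rewrite mulr_sumr.
have -> : \sum_i \sum_j low i j = 2 * beta * \sum_i \sum_j b i * b j
   - 2 * beta * (\sum_i \sum_j g i * x j + \sum_i \sum_j x i * g j)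
   - 4 * beta * \sum_i \sum_j x i * x j.
  rewrite -!big_split !mulr_sumr -!sumrB; apply: eq_bigr => i _ /=.
  by rewrite -!big_split !mulr_sumr -!sumrB.
by rewrite !dbl /s /v /w; field.
Qed.

Let sum_exc : \sum_i \sum_j exc i j <= 3 * K.
Proof.
have one (P : bool) (u : 'I_k) : \sum_j (P && (u == j))%:R <= 1 :> R.
  rewrite (bigD1 u) //= eqxx andbT [X in _ + X]big1 ?addr0 => [|j /negbTE]; first by case: P.
  by rewrite eq_sym => ->; rewrite andbF.
have tot (f : 'I_k -> R) : (forall i, f i <= 1) -> \sum_i f i <= K.
  by move=> h; apply: le_trans (ler_sum _ (fun i _ => h i)) _; rewrite sumr_const card_ord.
have -> : \sum_i \sum_j exc i j = \sum_(i < k) \sum_(j < k) (true && (i == j))%:R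
   + \sum_(i < k) \sum_(j < k) (X i && (big i == j))%:R
   + \sum_(j < k) \sum_(i < k) (X j && (big j == i))%:R.
  rewrite [X in _ + X]exchange_big -!big_split; apply: eq_bigr => i _ /=.
  by rewrite -!big_split.
have h1 := tot _ (fun i => one true i).
have h2 := tot _ (fun i => one (X i) (big i)).
lra.
Qed.

(** A unit of [DEV / K] costs 2 beta in the stars and weakens the clique bound by 7/2. Since 2 beta
    > 7/2, deviations never help, and [mean_cost_bound] finishes. *)
Lemma profile_lower_bound : 4 * K - 64 <= \sum_l profile_val (pred1 l) (z l).
Proof.
have beta0 : 0 < beta by rewrite /star_weight; lra.
have s0 : 0 <= s by rewrite divr_ge0 ?(ltW K_gt0) // sumr_ge0 // => i _; rewrite /b.
have v0 : 0 <= v by rewrite divr_ge0 ?(ltW K_gt0) // sumr_ge0 // => i _; rewrite /g.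
have w0 : 0 <= w by rewrite divr_ge0 ?(ltW K_gt0) // sumr_ge0 // => i _; rewrite /x.
have mc := mean_cost_bound s0 v0 w0 types_sum.
set DEV := \sum_i \sum_j dev z B G i j.
have DEV0 : 0 <= DEV by rewrite sumr_ge0 // => i _; rewrite sumr_ge0 // => j _; apply: dev_ge0.
have rows : \sum_i row_cost (y ^~ i) i >=
   \sum_i base i + (\sum_i \sum_j low i j + 2 * beta * DEV - 6 * beta * K) / K.
  under [leRHS]eq_bigr => i _ do rewrite row_cost_linear.
  rewrite big_split /= lerD2l -mulr_suml ler_pM2r ?invr_gt0 //.
  have -> : \sum_i \sum_j (slope i i j + slope i j i) = \sum_i \sum_j (slope i i j + slope j i j).
    transitivity (\sum_i \sum_j slope i i j + \sum_i \sum_j slope i j i).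
      by rewrite -big_split; apply: eq_bigr => i _; rewrite -big_split.
    rewrite [X in _ + X]exchange_big -big_split; apply: eq_bigr => i _ /=.
    by rewrite -big_split.
  apply: (@le_trans _ _ (\sum_i \sum_j (low i j + 2 * beta * dev z B G i j - 2 * beta * exc i j))); last first.
    by apply: ler_sum => i _; apply: ler_sum => j _; apply: pair_bound.
  have -> : \sum_i \sum_j (low i j + 2 * beta * dev z B G i j - 2 * beta * exc i j) =
    \sum_i \sum_j low i j + 2 * beta * DEV - 2 * beta * \sum_i \sum_j exc i j.
    rewrite /DEV !mulr_sumr -!big_split -sumrB; apply: eq_bigr => i _ /=.
    by rewrite !mulr_sumr -!big_split -sumrB.
  have := sum_exc; move: (\sum_i \sum_j exc i j) => S hS.
  have := ler_wpM2l (ltW beta0) hS; lra.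
set CUT := \sum_(e : {ffun 'I_8 -> 'I_k}) \sum_l cutsize (load z e l).
(* 840 = 9 * 56 + 336 collects collisions and strays. *)
have cliques : K ^+ 8 * mean_count s v - 56 * K ^+ 6 * DEV - 840 * K ^+ 7 <= CUT.
  have h : \sum_(e : {ffun 'I_8 -> 'I_k}) label_count R B G X e <= \sum_(e : {ffun 'I_8 -> 'I_k})
     (9 * collide R e + (\sum_l cutsize (load z e l) + \sum_a \sum_(c | c != a) (dev z B G (e a) (e c) + stray z e a c))).
    by apply: ler_sum => e _; exact: (label_count_le z_ge0 z_sum BGX e).
  move: h; rewrite [X in _ <= X]big_split /= -[X in _ <= X + _]mulr_sumr sum_tuple_collide [X in _ <= _ + X]big_split /= -/CUT.
  have -> : \sum_(e : {ffun 'I_8 -> 'I_k}) \sum_a \sum_(c | c != a) (dev z B G (e a) (e c) + stray z e a c) =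
     56 * K ^+ 6 * DEV + 336 * K ^+ 7.
    rewrite -(sum_tuple_stray z_sum) -(sum_tuple_pairs (dev z B G)) -big_split /=.
    apply: eq_bigr => e _; rewrite -big_split /=; apply: eq_bigr => a _.
    by rewrite -big_split.
  rewrite sum_tuple_label_count.
  have -> : \sum_i (~~ X i)%:R = K * (s + v).
    have -> : K * (s + v) = \sum_i (b i + g i) by rewrite big_split /= /s /v; field.
    apply: eq_bigr => i _; have := BGX i; rewrite /b /g.
    by case: (B i); case: (G i); case: (X i) => //= _; ring.
  have -> : \sum_i (B i)%:R = K * s by rewrite /s; field.
  have -> : \sum_i (G i)%:R = K * v by rewrite /v; field.
  rewrite /mean_count; lra.
have -> : \sum_l profile_val (pred1 l) (z l) = \sum_i row_cost (y ^~ i) i + K / 16 / K ^+ 8 * CUT.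
  rewrite /profile_val big_split /= -mulr_sumr [X in _ + _ * X]exchange_big /=; congr (_ + _).
  rewrite exchange_big /=; apply: eq_bigr => i _; apply: eq_bigr => l _ /=.
  by rewrite eq_sym.
have c0 : 0 <= K / 16 / K ^+ 8 by rewrite !divr_ge0 ?exprn_ge0 ?(ltW K_gt0).
have {}cliques := ler_wpM2l c0 cliques.
have e1 : K / 16 / K ^+ 8 * (K ^+ 8 * mean_count s v - 56 * K ^+ 6 * DEV - 840 * K ^+ 7) =
  K / 16 * mean_count s v - 7 / 2 * (DEV / K) - 105 / 2 by field.
have e2 : (\sum_i \sum_j low i j + 2 * beta * DEV - 6 * beta * K) / K =
  K * (2 * beta * s ^+ 2 - 4 * beta * (v * w) - 4 * beta * w ^+ 2) + 2 * beta * (DEV / K) - 6 * beta.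
  by rewrite sum_low; field.
rewrite {}e1 in cliques; rewrite {}e2 sum_base in rows.
have D0 : 0 <= DEV / K by rewrite divr_ge0 // ltW.
have {}mc := ler_wpM2l (ltW K_gt0) mc.
move: cliques rows D0 mc; move: (DEV / K) (_ * CUT) (\sum_i _) => D C S.
(* The constant errors 6 beta + 105 / 2 stay below 64. *)
rewrite /star_weight; lra.
Qed.

End LowerBound.

(** * Planted functions *)

Section Hidden.
Variables (R : realFieldType) (delta : R).
Hypothesis delta_gt0 : 0 < delta.
Hypothesis delta_small : delta <= 1 / 1000.
Local Notation beta := (star_weight R).

(* A supermodular function equal to max 0 (u + v) when u and v are close, and
   within delta of max 0 u + max 0 v when they have opposite signs: it detects
   a set that contains one half of every block of a star. *)
Definition hinge (u v : R) : R := Num.max (Num.max 0 (u + v)) (Num.max (u - delta) (v - delta)).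

Lemma hinge_ge u v : [/\ 0 <= hinge u v, u + v <= hinge u v, u - delta <= hinge u v & v - delta <= hinge u v].
Proof. by rewrite /hinge; split; rewrite !le_max lexx ?orbT. Qed.

Lemma hinge_cases u v :
  [\/ hinge u v = 0, hinge u v = u + v, hinge u v = u - delta | hinge u v = v - delta].
Proof.
have maxE (a b : R) : Num.max a b = a \/ Num.max a b = b by case: (leP a b); [right|left].
rewrite /hinge; case: (maxE (Num.max 0 (u + v)) (Num.max (u - delta) (v - delta))) => ->.
  by case: (maxE 0 (u + v)) => ->; [constructor 1|constructor 2].
by case: (maxE (u - delta) (v - delta)) => ->; [constructor 3|constructor 4].
Qed.

Lemma hingeC u v : hinge u v = hinge v u.
Proof. by rewrite /hinge addrC [Num.max (u - _) _]maxC. Qed.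

(** Whatever pieces are active on the left, the bounds of [hinge_ge] at join and meet cover them;
    for instance u1 - delta and v2 - delta are covered by uj + vj and 0. *)
Lemma hinge_super (u1 v1 u2 v2 ui vi uj vj : R) :
  ui <= u1 -> ui <= u2 -> vi <= v1 -> vi <= v2 -> u1 <= uj -> u2 <= uj -> v1 <= vj -> v2 <= vj ->
  uj + ui = u1 + u2 -> vj + vi = v1 + v2 ->
  hinge u1 v1 + hinge u2 v2 <= hinge uj vj + hinge ui vi.
Proof.
move=> *; have dl := delta_gt0; have [a1 a2 a3 a4] := hinge_ge uj vj; have [b1 b2 b3 b4] := hinge_ge ui vi.
by case: (hinge_cases u1 v1) => ->; case: (hinge_cases u2 v2) => ->; lra.
Qed.

(** In [u] the hinge has slope 0 or 1, and slope 1 only for u >= - delta: below that, v - delta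
    exceeds u + v and 0 exceeds u - delta. *)
Lemma hinge_incr (u u' v : R) : u <= u' ->
  hinge u' v - hinge u v <= Num.max 0 (u' + delta) - Num.max 0 (u + delta).
Proof.
move=> uu; have dl := delta_gt0; have [b1 b2 b3 b4] := hinge_ge u v.
by case: (hinge_cases u' v) => ->; case: (leP 0 (u' + delta)); case: (leP 0 (u + delta)); lra.
Qed.

(* [r] and [c] are the fractions of the rows (i, _, _) and (_, i, _). *)
Definition star0 (r c : R) : R :=
  beta * (r + c) - 2 * hinge (beta * r - (1 + beta) / 2) (beta * c - (1 + beta) / 2).

(** A set with the terminal pays for its complement, which makes the star symmetric. *)
Definition star (tau : bool) (r c : R) : R := if tau then star0 (1 - r) (1 - c) else star0 r c.

Lemma star0_ge0 r c : 0 <= r <= 1 -> 0 <= c <= 1 -> 0 <= star0 r c.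
Proof.
move=> /andP[r0 r1] /andP[c0 c1]; have dl := delta_gt0; rewrite /star0 /star_weight.
by case: (hinge_cases (219 / 115 * r - (1 + 219 / 115) / 2) (219 / 115 * c - (1 + 219 / 115) / 2)) => ->; lra.
Qed.

Lemma star0_sub (r1 c1 r2 c2 ri ci rj cj : R) :
  ri <= r1 <= rj -> ri <= r2 <= rj -> ci <= c1 <= cj -> ci <= c2 <= cj ->
  rj + ri = r1 + r2 -> cj + ci = c1 + c2 ->
  star0 rj cj + star0 ri ci <= star0 r1 c1 + star0 r2 c2.
Proof.
move=> /andP[? ?] /andP[? ?] /andP[? ?] /andP[? ?] hr hc.
have h := @hinge_super (beta * r1 - (1 + beta) / 2) (beta * c1 - (1 + beta) / 2) (beta * r2 - (1 + beta) / 2)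
  (beta * c2 - (1 + beta) / 2) (beta * ri - (1 + beta) / 2) (beta * ci - (1 + beta) / 2)
  (beta * rj - (1 + beta) / 2) (beta * cj - (1 + beta) / 2).
have {}h := h _ _ _ _ _ _ _ _ _ _; rewrite /star0.
suff : hinge (beta * r1 - (1 + beta) / 2) (beta * c1 - (1 + beta) / 2) + hinge (beta * r2 - (1 + beta) / 2) (beta * c2 - (1 + beta) / 2)
  <= hinge (beta * rj - (1 + beta) / 2) (beta * cj - (1 + beta) / 2) + hinge (beta * ri - (1 + beta) / 2) (beta * ci - (1 + beta) / 2).
  move: (hinge _ _) (hinge (_ * r2 - _) _) (hinge (_ * rj - _) _) (hinge (_ * ri - _) _) => a b c d.
  rewrite /star_weight; lra.
by apply: h; rewrite /star_weight; lra.
Qed.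

(** Gives submodularity when exactly one of two sets contains the terminal. The linear terms grow at
    rate 2 beta and each hinge removes at most 2 beta; their steep ranges are disjoint because beta
    < 1 + beta - 2 delta. *)
Lemma star0_diff_mono1 (r r' c : R) : 0 <= r -> r <= r' -> r' <= 1 ->
  star0 r c - star0 (1 - r) (1 - c) <= star0 r' c - star0 (1 - r') (1 - c).
Proof.
move=> r0 rr r1; have ds := delta_small; rewrite /star0.
have h1 : beta * r - (1 + beta) / 2 <= beta * r' - (1 + beta) / 2 by rewrite /star_weight; lra.
have h2 : beta * (1 - r') - (1 + beta) / 2 <= beta * (1 - r) - (1 + beta) / 2 by rewrite /star_weight; lra.
have := hinge_incr (beta * c - (1 + beta) / 2) h1.
have := hinge_incr (beta * (1 - c) - (1 + beta) / 2) h2.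
move: (hinge _ _) (hinge (_ * (1 - r') - _) _) (hinge (_ * r' - _) _) (hinge (_ * r - _) _) => a b d f.
rewrite /star_weight.
case: (leP 0 (219 / 115 * (1 - r) - (1 + 219 / 115) / 2 + delta)) => ?;
case: (leP 0 (219 / 115 * (1 - r') - (1 + 219 / 115) / 2 + delta)) => ?;
case: (leP 0 (219 / 115 * r - (1 + 219 / 115) / 2 + delta)) => ?;
case: (leP 0 (219 / 115 * r' - (1 + 219 / 115) / 2 + delta)) => ? => ? ?; lra.
Qed.

Lemma star0C r c : star0 r c = star0 c r.
Proof. by rewrite /star0 hingeC [r + c]addrC. Qed.

Lemma star0_diff_mono (r r' c c' : R) : 0 <= r -> r <= r' -> r' <= 1 -> 0 <= c -> c <= c' -> c' <= 1 ->
  star0 r c - star0 (1 - r) (1 - c) <= star0 r' c' - star0 (1 - r') (1 - c').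
Proof.
move=> r0 rr r1 c0 cc c1; apply: (le_trans (star0_diff_mono1 c r0 rr r1)).
rewrite ![star0 r' _]star0C ![star0 (1 - r') _]star0C; exact: star0_diff_mono1.
Qed.

Lemma star_sub t1 t2 (r1 c1 r2 c2 ri ci rj cj : R) : 0 <= ri -> rj <= 1 -> 0 <= ci -> cj <= 1 ->
  ri <= r1 <= rj -> ri <= r2 <= rj -> ci <= c1 <= cj -> ci <= c2 <= cj ->
  rj + ri = r1 + r2 -> cj + ci = c1 + c2 ->
  star (t1 || t2) rj cj + star (t1 && t2) ri ci <= star t1 r1 c1 + star t2 r2 c2.
Proof.
move=> ri0 rj1 ci0 cj1 /andP[a1 a2] /andP[a3 a4] /andP[b1 b2] /andP[b3 b4] hr hc.
have s1 : star0 rj cj + star0 ri ci <= star0 r1 c1 + star0 r2 c2.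
  by apply: star0_sub => //; apply/andP; split.
have s2 : star0 (1 - ri) (1 - ci) + star0 (1 - rj) (1 - cj) <= star0 (1 - r1) (1 - c1) + star0 (1 - r2) (1 - c2).
  by apply: star0_sub; try (apply/andP; split); lra.
case: t1; case: t2; rewrite /star /=.
- lra.
- have := @star0_diff_mono ri r2 ci c2; lra.
- have := @star0_diff_mono ri r1 ci c1; lra.
- lra.
Qed.

(** For nearby r and c the arguments of the hinge differ by at most beta delta < 2 delta, so its two
    shifted pieces are never the largest. *)
Lemma star0_tent r c : `|r - c| <= delta -> star0 r c = tent (r + c).
Proof.
rewrite ler_norml => /andP[h1 h2]; have dl := delta_gt0; rewrite /star0.
have -> : hinge (beta * r - (1 + beta) / 2) (beta * c - (1 + beta) / 2) = Num.max 0 (beta * (r + c) - (1 + beta)).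
  rewrite /hinge -[in RHS](_ : beta * r - (1 + beta) / 2 + (beta * c - (1 + beta) / 2) = beta * (r + c) - (1 + beta)); last by field.
  apply: max_l; rewrite le_max ge_max /star_weight.
  apply/orP; rewrite !ge_max.
  case: (leP 0 (219 / 115 * r - (1 + 219 / 115) / 2 + (219 / 115 * c - (1 + 219 / 115) / 2))) => h; [right|left];
    by apply/andP; split; lra.
case: (leP (beta * (r + c)) (1 + beta)) => h.
  rewrite tentl // max_l; lra.
rewrite tentr ?ltW // max_r; lra.
Qed.

Lemma star_tent t r c : `|r - c| <= delta ->
  star t r c = if t then tent (2 - (r + c)) else tent (r + c).
Proof.
move=> h; rewrite /star; case: t; last exact: star0_tent.
rewrite star0_tent; first by congr tent; ring.
by rewrite (_ : 1 - r - (1 - c) = - (r - c)) ?normrN //; ring.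
Qed.

(** * The planted clique cut *)

Section Half.
Variable k : nat.
Implicit Types d : 'I_k -> 'I_k -> R.
Variable e : 'I_8 -> 'I_k.

Definition part_load d a : R := 2 * \sum_(b | b != a) d (e a) (e b).
(* The cap is just above 1/2: on a balanced set it is never active before the
   outer cap, but it halves the cost of a set that is one entire secret part. *)
Definition half_cut d : R := Num.min 1 (\sum_a Num.min (part_load d a) (1 / 2 + 20 * delta)).
Definition compl_profile d : 'I_k -> 'I_k -> R := fun i j => 1 - d i j.
Definition clique_cut d : R := half_cut d + half_cut (compl_profile d) - 1.

Lemma min_sub (h x1 x2 xi xj : R) : xi <= x1 <= xj -> xi <= x2 <= xj -> xj + xi = x1 + x2 ->
  Num.min xj h + Num.min xi h <= Num.min x1 h + Num.min x2 h :> R.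
Proof.
move=> /andP[? ?] /andP[? ?] ?.
by case: (leP xj h); case: (leP xi h); case: (leP x1 h); case: (leP x2 h); lra.
Qed.

Lemma min1_sub (x1 x2 xi xj : R) : xi <= x1 <= xj -> xi <= x2 <= xj -> xj + xi <= x1 + x2 ->
  Num.min 1 xj + Num.min 1 xi <= Num.min 1 x1 + Num.min 1 x2.
Proof.
move=> /andP[? ?] /andP[? ?] ?.
by case: (leP 1 xj); case: (leP 1 xi); case: (leP 1 x1); case: (leP 1 x2); lra.
Qed.

Lemma part_load_le d d' a : (forall i j, d i j <= d' i j) -> part_load d a <= part_load d' a.
Proof. by move=> h; rewrite ler_pM2l // ler_sum. Qed.

(** Concave functions of modular functions are submodular, and truncating a monotone submodular
    function keeps it so. *)
Lemma half_cut_sub d1 d2 di dj : (forall i j, di i j <= d1 i j <= dj i j) ->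
  (forall i j, di i j <= d2 i j <= dj i j) -> (forall i j, dj i j + di i j = d1 i j + d2 i j) ->
  half_cut dj + half_cut di <= half_cut d1 + half_cut d2.
Proof.
move=> h1 h2 hs.
have l1 a : part_load di a <= part_load d1 a <= part_load dj a.
  by apply/andP; split; apply: part_load_le => i j; have /andP[] := h1 i j.
have l2 a : part_load di a <= part_load d2 a <= part_load dj a.
  by apply/andP; split; apply: part_load_le => i j; have /andP[] := h2 i j.
have ls a : part_load dj a + part_load di a = part_load d1 a + part_load d2 a.
  by rewrite /part_load -!mulrDr -!big_split /=; congr (_ * _); apply: eq_bigr => b _.
have mono d d' : (forall a, part_load d a <= part_load d' a) ->
   \sum_a Num.min (part_load d a) (1 / 2 + 20 * delta) <= \sum_a Num.min (part_load d' a) (1 / 2 + 20 * delta).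
  by move=> h; apply: ler_sum => a _; rewrite le_min !ge_min h lexx orbT.
apply: min1_sub.
- by apply/andP; split; apply: mono => a; have /andP[] := l1 a.
- by apply/andP; split; apply: mono => a; have /andP[] := l2 a.
rewrite -!big_split /=; apply: ler_sum => a _; exact: min_sub.
Qed.

Lemma clique_cut_sub d1 d2 di dj : (forall i j, di i j <= d1 i j <= dj i j) ->
  (forall i j, di i j <= d2 i j <= dj i j) -> (forall i j, dj i j + di i j = d1 i j + d2 i j) ->
  clique_cut dj + clique_cut di <= clique_cut d1 + clique_cut d2.
Proof.
move=> h1 h2 hs; have a := half_cut_sub h1 h2 hs.
have : half_cut (compl_profile di) + half_cut (compl_profile dj) <= half_cut (compl_profile d1) + half_cut (compl_profile d2).
  apply: half_cut_sub => i j; rewrite /compl_profile.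
  - by have /andP[? ?] := h1 i j; apply/andP; split; lra.
  - by have /andP[? ?] := h2 i j; apply/andP; split; lra.
  - have := hs i j; lra.
rewrite /clique_cut; lra.
Qed.

Lemma part_load_compl d a : part_load (compl_profile d) a = 14 - part_load d a.
Proof.
have E7 : \sum_(b < 8 | b != a) 1 = 7 :> R by rewrite sumr_const cardC1 card_ord.
by rewrite /part_load /compl_profile sumrB E7; ring.
Qed.

(** The two loads of a position add up to 14, so each position gives at least 1/2 to one side; of a
    total of at least 4, one side gets at least 1. *)
Lemma clique_cut_ge0 d : (forall i j, 0 <= d i j <= 1) -> 0 <= clique_cut d.
Proof.
move=> d01.
have pl a : 0 <= part_load d a <= 14.
  apply/andP; split; first by rewrite mulr_ge0 // sumr_ge0 // => b _; have /andP[] := d01 (e a) (e b).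
  have : 0 <= part_load (compl_profile d) a.
    by rewrite mulr_ge0 // sumr_ge0 // => b _; rewrite subr_ge0; have /andP[] := d01 (e a) (e b).
  rewrite part_load_compl; lra.
have h0 := delta_gt0.
rewrite /clique_cut /half_cut; set A := (X in Num.min 1 X + _); set A' := (X in _ + Num.min 1 X - _).
have : 4 <= A + A'.
  have -> : 4 = \sum_(a < 8) (1 / 2) :> R by rewrite sumr_const card_ord; lra.
  rewrite /A /A' -big_split; apply: ler_sum => a _ /=; rewrite part_load_compl.
  have /andP[] := pl a.
  by case: (leP (part_load d a) (1 / 2 + 20 * delta)); case: (leP (14 - part_load d a) (1 / 2 + 20 * delta)); lra.
have A0 : 0 <= A by rewrite sumr_ge0 // => a _; rewrite le_min; apply/andP; split; [have /andP[] := pl a|lra].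
have A0' : 0 <= A' by rewrite sumr_ge0 // => a _; rewrite le_min part_load_compl; have /andP[? ?] := pl a; apply/andP; split; lra.
by case: (leP 1 A); case: (leP 1 A'); lra.
Qed.

(** If the cap binds at [a], balance transfers that load, up to 14 delta < 20 delta, to the other
    positions; both sums then reach 1 and the outer cap hides the difference. *)
Lemma half_cut_balanced d : (forall i j, 0 <= d i j) -> (forall i j, `|d i j - d j i| <= delta) ->
  half_cut d = Num.min 1 (2 * \sum_a \sum_(b | b != a) d (e a) (e b)).
Proof.
move=> d0 bal.
have -> : 2 * \sum_a \sum_(b | b != a) d (e a) (e b) = \sum_a part_load d a by rewrite mulr_sumr.
have pl0 a : 0 <= part_load d a by rewrite mulr_ge0 // sumr_ge0.
have dl := delta_gt0.
case: (pickP [pred a | 1 / 2 + 20 * delta < part_load d a]) => [a /= ha|small]; last first.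
  rewrite /half_cut; congr Num.min; apply: eq_bigr => a _; apply: min_l.
  by rewrite leNgt; have := small a; rewrite /= => ->.
have rest : 1 / 2 <= \sum_(b | b != a) part_load d b.
  apply: (@le_trans _ _ (2 * \sum_(b | b != a) d (e b) (e a))); last first.
    rewrite mulr_sumr; apply: ler_sum => b ba; rewrite ler_pM2l //.
    by rewrite (bigD1 a) 1?eq_sym //= lerDl sumr_ge0.
  have : \sum_(b | b != a) d (e a) (e b) - \sum_(b | b != a) d (e b) (e a) <= 7 * delta.
    rewrite -sumrB.
    have -> : 7 * delta = \sum_(b < 8 | b != a) delta by rewrite sumr_const cardC1 card_ord mulr_natl.
    by apply: ler_sum => b _; apply: le_trans (bal _ _); apply: ler_norm.
  move: ha; rewrite /part_load; lra.
rewrite /half_cut !min_l //.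
  rewrite (bigD1 a) //=; lra.
rewrite (bigD1 a) //= min_r ?ltW //.
have h0 : 0 <= 1 / 2 + 20 * delta by lra.
have := sum_min_ge (fun b => b != a) h0 pl0.
by case: (leP (\sum_(b | b != a) part_load d b) (1 / 2 + 20 * delta)) => h; lra.
Qed.

Lemma clique_cut_balanced d : (forall i j, 0 <= d i j <= 1) -> (forall i j, `|d i j - d j i| <= delta) ->
  clique_cut d = cutsize (2 * \sum_a \sum_(b | b != a) d (e a) (e b)).
Proof.
move=> d01 bal; rewrite /clique_cut /cutsize !half_cut_balanced //.
- congr (_ + Num.min 1 _ - 1); rewrite /compl_profile.
  under eq_bigr => a _ do rewrite sumrB.
  by rewrite sumrB sum_pairs_const; ring.
- by move=> i j; rewrite subr_ge0; have /andP[] := d01 i j.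
- by move=> i j; rewrite /compl_profile (_ : 1 - d i j - (1 - d j i) = d j i - d i j) //; ring.
- by move=> i j; have /andP[] := d01 i j.
Qed.

End Half.

(** * The planted function and its secret partition *)

Section Value.
Variable k : nat.
Hypothesis k_gt0 : (0 < k)%N.
Implicit Types (d : 'I_k -> 'I_k -> R) (t : 'I_k -> bool).
Let K : R := k%:R.
Let K_gt0 : 0 < K. Proof. by rewrite ltr0n. Qed.

Definition row_avg d i : R := (\sum_j d i j) / k%:R.
Definition col_avg d i : R := (\sum_j d j i) / k%:R.

Definition hidden_val t d : R :=
  \sum_i star (t i) (row_avg d i) (col_avg d i)
  + k%:R / 16 / k%:R ^+ 8 * \sum_(e : {ffun 'I_8 -> 'I_k}) clique_cut e d.

Let coef_ge0 : 0 <= k%:R / 16 / k%:R ^+ 8 :> R.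
Proof. by rewrite divr_ge0 ?exprn_ge0 // divr_ge0. Qed.

Let avg_compl (f : 'I_k -> R) : (\sum_j (1 - f j)) / K = 1 - (\sum_j f j) / K.
Proof. by rewrite sumrB sumr_const card_ord mulrBl divff // gt_eqF. Qed.

Lemma hidden_val_compl t d : hidden_val (fun i => ~~ t i) (compl_profile d) = hidden_val t d.
Proof.
have cc e : clique_cut e (compl_profile d) = clique_cut e d.
  rewrite /clique_cut [half_cut e (compl_profile (compl_profile d))](_ : _ = half_cut e d); first by rewrite [half_cut e d + _]addrC.
  by rewrite /half_cut /part_load /compl_profile; congr Num.min; apply: eq_bigr => a _; congr (Num.min (2 * _) _); apply: eq_bigr => b _; ring.
rewrite /hidden_val; congr (_ + _ * _); last by apply: eq_bigr => e _; apply: cc.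
apply: eq_bigr => i _; rewrite /row_avg /col_avg /compl_profile !avg_compl /star.
by case: (t i) => //=; rewrite !subKr.
Qed.

Let avg01 (f : 'I_k -> R) : (forall j, 0 <= f j <= 1) -> 0 <= (\sum_j f j) / K <= 1.
Proof.
move=> f01; rewrite divr_ge0 ?(ltW K_gt0) ?sumr_ge0 //=; last by move=> j _; have /andP[] := f01 j.
rewrite ler_pdivrMr // mul1r; apply: (@le_trans _ _ (\sum_(j < k) 1)); last by rewrite sumr_const card_ord.
by apply: ler_sum => j _; have /andP[] := f01 j.
Qed.

Lemma hidden_val_ge0 t d : (forall i j, 0 <= d i j <= 1) -> 0 <= hidden_val t d.
Proof.
move=> d01; apply: addr_ge0; last first.
  by apply: mulr_ge0 => //; apply: sumr_ge0 => e _; apply: clique_cut_ge0.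
apply: sumr_ge0 => i _.
have /andP[r0 r1] : 0 <= row_avg d i <= 1 by apply: avg01.
have /andP[c0 c1] : 0 <= col_avg d i <= 1 by apply: (avg01 (f := d ^~ i)).
by rewrite /star; case: (t i); apply: star0_ge0; apply/andP; split; lra.
Qed.

Let avg_le (f g : 'I_k -> R) : (forall j, f j <= g j) -> (\sum_j f j) / K <= (\sum_j g j) / K.
Proof. by move=> h; rewrite ler_pM2r ?invr_gt0 // ler_sum. Qed.

Lemma hidden_val_sub t1 t2 d1 d2 di dj : (forall i j, 0 <= di i j) -> (forall i j, dj i j <= 1) ->
  (forall i j, di i j <= d1 i j <= dj i j) -> (forall i j, di i j <= d2 i j <= dj i j) ->
  (forall i j, dj i j + di i j = d1 i j + d2 i j) ->
  hidden_val (fun i => t1 i || t2 i) dj + hidden_val (fun i => t1 i && t2 i) di <=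
  hidden_val t1 d1 + hidden_val t2 d2.
Proof.
move=> di0 dj1 h1 h2 hs; rewrite /hidden_val addrACA [leRHS]addrACA lerD //.
  rewrite -!big_split /=; apply: ler_sum => i _; apply: star_sub.
  - by rewrite divr_ge0 ?(ltW K_gt0) ?sumr_ge0.
  - apply: (@le_trans _ _ ((\sum_(j < k) 1) / K)); first exact: avg_le.
    by rewrite sumr_const card_ord divff // gt_eqF.
  - by rewrite divr_ge0 ?(ltW K_gt0) ?sumr_ge0.
  - apply: (@le_trans _ _ ((\sum_(j < k) 1) / K)); first exact: avg_le.
    by rewrite sumr_const card_ord divff // gt_eqF.
  - by apply/andP; split; apply: avg_le => j; have /andP[] := h1 i j.
  - by apply/andP; split; apply: avg_le => j; have /andP[] := h2 i j.
  - by apply/andP; split; apply: avg_le => j; have /andP[] := h1 j i.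
  - by apply/andP; split; apply: avg_le => j; have /andP[] := h2 j i.
  - by rewrite /row_avg -!mulrDl -!big_split; congr (_ / _); apply: eq_bigr => j _; apply: hs.
  - by rewrite /col_avg -!mulrDl -!big_split; congr (_ / _); apply: eq_bigr => j _; apply: hs.
rewrite -!mulrDr ler_wpM2l // -!big_split /=; apply: ler_sum => e _; exact: clique_cut_sub.
Qed.

Lemma hidden_val_balanced t d : (forall i j, 0 <= d i j <= 1) -> (forall i j, `|d i j - d j i| <= delta) ->
  hidden_val t d = profile_val t d.
Proof.
move=> d01 bal; rewrite /hidden_val /profile_val; congr (_ + _ * _); last first.
  by apply: eq_bigr => e _; apply: clique_cut_balanced.
apply: eq_bigr => i _; rewrite star_tent; last first.
  rewrite /row_avg /col_avg -mulrBl -sumrB normrM normfV [`|k%:R|]ger0_norm // ler_pdivrMr //.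
  apply: le_trans (ler_norm_sum _ _ _) _.
  have -> : delta * k%:R = \sum_(j < k) delta by rewrite sumr_const card_ord mulr_natr.
  exact: ler_sum.
by rewrite /row_avg /col_avg -mulrDl -big_split.
Qed.

(** Part [l] of the secret partition has full row [l], and every column average is 1 / k. The piece
    v - delta of the hinge lowers star [l] to 1 + beta / k + 2 delta; the other k - 1 stars cost at
    most beta / k each. In a clique every position pays at most the cap, for a single [l]. *)
Lemma hidden_val_planted :
  \sum_l hidden_val (pred1 l) (fun i _ => (i == l)%:R) <= K * (5 / 4 + beta + 12 * delta) + beta.
Proof.
have Kn0 : K != 0 by rewrite gt_eqF.
have dl := delta_gt0.
have K1 : 1 <= K by rewrite ler1n.
rewrite /hidden_val big_split /= -mulr_sumr [X in _ + _ * X]exchange_big /=.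
have stars l : \sum_i star (pred1 l i) (row_avg (fun i _ => (i == l)%:R) i) (col_avg (fun i _ => (i == l)%:R) i)
   <= 1 + 2 * delta + beta.
  have colE i : col_avg (fun i _ => (i == l)%:R) i = K^-1.
    by rewrite /col_avg (bigD1 l) //= eqxx big1 ?addr0 ?mul1r // => j /negbTE ->.
  have rowE i : row_avg (fun i _ => (i == l)%:R) i = (i == l)%:R.
    by rewrite /row_avg sumr_const card_ord -[(i == l)%:R *+ k]mulr_natr mulfK.
  rewrite (bigD1 l) //= rowE colE eqxx /=.
  have -> : 1 + 2 * delta + beta = (1 + beta / K + 2 * delta) + (K - 1) * (beta / K) by field.
  apply: lerD.
    rewrite /star /star0; have [_ _ _] := hinge_ge (beta * (1 - 1) - (1 + beta) / 2) (beta * (1 - K^-1) - (1 + beta) / 2).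
    rewrite subrr; move: (hinge _ _) => h; lra.
  have -> : (K - 1) * (beta / K) = \sum_(i < k | i != l) (beta / K).
    rewrite sumr_const cardC1 card_ord -mulr_natl; congr (_ * _).
    by rewrite -subn1 natrB.
  apply: ler_sum => i /negbTE il; rewrite rowE colE il mulr0n /star /star0 /=.
  have [h _ _ _] := hinge_ge (beta * 0 - (1 + beta) / 2) (beta * K^-1 - (1 + beta) / 2).
  move: h; move: (hinge _ _) => h; lra.
have cuts (e : {ffun 'I_8 -> 'I_k}) : \sum_l clique_cut e (fun i _ => (i == l)%:R) <= 8 * (1 / 2 + 20 * delta).
  have one l : clique_cut e (fun i _ => (i == l)%:R) <= \sum_a (e a == l)%:R * (1 / 2 + 20 * delta).
    rewrite /clique_cut.
    have h1 : half_cut e (compl_profile (fun i _ : 'I_k => (i == l)%:R)) <= 1 by rewrite /half_cut ge_min lexx.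
    suff : half_cut e (fun i _ => (i == l)%:R) <= \sum_a (e a == l)%:R * (1 / 2 + 20 * delta) by lra.
    rewrite /half_cut ge_min; apply/orP; right; apply: ler_sum => a _.
    rewrite /part_load; case: (e a == l); first by rewrite [leRHS]mul1r ge_min lexx orbT.
    by rewrite big1 // mulr0 [leRHS]mul0r ge_min lexx.
  apply: le_trans (ler_sum _ (fun l _ => one l)) _; rewrite exchange_big /=.
  rewrite (eq_bigr (fun=> 1 / 2 + 20 * delta)) => [|a _]; last first.
    rewrite (bigD1 (e a)) //= eqxx [X in _ + X]big1 ?addr0 ?[LHS]mul1r // => l.
    by rewrite eq_sym => /negbTE ->; rewrite mul0r.
  by rewrite sumr_const card_ord [leRHS]mulr_natl.
apply: (@le_trans _ _ (\sum_(l < k) (1 + 2 * delta + beta) +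
    k%:R / 16 / k%:R ^+ 8 * \sum_(e : {ffun 'I_8 -> 'I_k}) (8 * (1 / 2 + 20 * delta)))).
  by apply: lerD; [apply: ler_sum => l _; apply: stars|apply: ler_wpM2l => //; apply: ler_sum => e _; apply: cuts].
rewrite !sumr_const card_ffun !card_ord -[(1 + 2 * delta + beta) *+ k]mulr_natr.
rewrite -[(8 * _) *+ _]mulr_natr natrX.
have -> : k%:R / 16 / k%:R ^+ 8 * (8 * (1 / 2 + 20 * delta) * k%:R ^+ 8) = K * (1 / 4 + 10 * delta) by field.
rewrite -/K /star_weight; lra.
Qed.

End Value.
End Hidden.

(** * The public function as a symmetrized planted function *)

Section Profiles.
Variables (R : realFieldType) (k : nat).
Implicit Types d : 'I_k -> 'I_k -> R.

Lemma sum_pairsC (I : finType) (f : I -> I -> R) :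
  \sum_a \sum_(b | b != a) f a b = \sum_a \sum_(b | b != a) f b a.
Proof.
have E (h : I -> I -> R) : \sum_a \sum_(b | b != a) h a b = \sum_a \sum_b (if b != a then h a b else 0).
  by apply: eq_bigr => a _; rewrite big_mkcond.
by rewrite !E exchange_big; apply: eq_bigr => a _; apply: eq_bigr => b _; rewrite eq_sym.
Qed.

(** Only the sums d i j + d j i matter, which makes the public function blind to the secret. *)
Lemma eq_profile_val t t' d d' : t =1 t' -> (forall i j, d i j + d j i = d' i j + d' j i) ->
  profile_val t d = profile_val t' d'.
Proof.
move=> tt dd; rewrite /profile_val; congr (_ + _ * _).
  by apply: eq_bigr => i _; rewrite tt; under eq_bigr do rewrite dd.
apply: eq_bigr => e _; congr cutsize.
have D (u : 'I_k -> 'I_k -> R) : 2 * \sum_a \sum_(b | b != a) u (e a) (e b) =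
   \sum_a \sum_(b | b != a) (u (e a) (e b) + u (e b) (e a)).
  under [RHS]eq_bigr do rewrite big_split /=.
  rewrite big_split /= -[X in _ + X](sum_pairsC (fun a b => u (e a) (e b))); ring.
by rewrite !D; apply: eq_bigr => a _; apply: eq_bigr => b _; apply: dd.
Qed.

Lemma eq_hidden_val delta t t' d d' : t =1 t' -> (forall i j, d i j = d' i j) ->
  hidden_val delta t d = hidden_val delta t' d'.
Proof.
move=> tt dd; rewrite /hidden_val; congr (_ + _ * _).
  apply: eq_bigr => i _; rewrite tt /row_avg /col_avg.
  by under eq_bigr do rewrite dd; under [X in star _ _ _ (X / _)]eq_bigr do rewrite dd.
apply: eq_bigr => e _; rewrite /clique_cut /half_cut /part_load /compl_profile.
by congr (Num.min _ _ + Num.min _ _ - _); apply: eq_bigr => a _; congr (Num.min (2 * _) _);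
  apply: eq_bigr => b _; rewrite dd.
Qed.

Definition sym_profile d i j : R := (d i j + d j i) / 2.

(** A symmetrized profile is balanced, so the public function inherits submodularity and symmetry
    from the planted one. *)
Lemma profile_val_sym delta t d : 0 < delta -> delta <= 1 / 1000 -> (0 < k)%N ->
  (forall i j, 0 <= d i j <= 1) -> hidden_val delta t (sym_profile d) = profile_val t d.
Proof.
move=> d0 d1 k0 d01; rewrite hidden_val_balanced //.
- by apply: eq_profile_val => // i j; rewrite /sym_profile; field.
- move=> i j; rewrite /sym_profile.
  by have /andP[? ?] := d01 i j; have /andP[? ?] := d01 j i; apply/andP; split; lra.
- by move=> i j; rewrite /sym_profile [d j i + _]addrC subrr normr0 ltW.
Qed.

End Profiles.

(** * Planting in a ground set *)

Section SetFunctions.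
Variables (R : realType) (delta : R) (k M n : nat).
Hypothesis delta_gt0 : 0 < delta.
Hypothesis delta_small : delta <= 1 / 1000.
Hypothesis k_gt0 : (0 < k)%N.
Hypothesis M_gt0 : (0 < M)%N.

(* [inl i] is the terminal i; the block of {i, j} consists of the elements (i, j, _),
   which the secret partition gives to i, and (j, i, _).  Injecting the sites in
   the ground set leaves some elements unused. *)
Local Notation site := ('I_k + 'I_k * 'I_k * 'I_M)%type.

Implicit Types (h : site -> 'I_n) (A B S : {set 'I_n}).

Definition has_terminal h S i : bool := h (inl i) \in S.
Definition density h S i j : R := (#|[pred c | h (inr (i, j, c)) \in S]|)%:R / M%:R.

Definition hidden_fun h S : R := hidden_val delta (has_terminal h S) (density h S).
Definition public_fun h S : R := profile_val (has_terminal h S) (density h S).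

Let M_gt0r : 0 < M%:R :> R. Proof. by rewrite ltr0n. Qed.

Lemma density01 h S i j : 0 <= density h S i j <= 1.
Proof.
rewrite divr_ge0 //= ler_pdivrMr // mul1r ler_nat -[leqRHS]card_ord; exact: max_card.
Qed.

Lemma densityUI h A B i j :
  density h (A :|: B) i j + density h (A :&: B) i j = density h A i j + density h B i j.
Proof.
rewrite /density -!mulrDl -!natrD; congr (_%:R / _).
rewrite -[RHS]cardUI; congr (_ + _)%N; apply: eq_card => c; by rewrite !inE.
Qed.

Lemma densityS h A B i j : A \subset B -> density h A i j <= density h B i j.
Proof.
move=> /subsetP AB; rewrite ler_pM2r ?invr_gt0 // ler_nat; apply: subset_leq_card.
by apply/subsetP => c; rewrite !inE => /AB.
Qed.

Lemma densityC h A i j : density h (~: A) i j = 1 - density h A i j.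
Proof.
apply: (mulIf (lt0r_neq0 M_gt0r)); rewrite /density mulrBl mul1r !divfK ?lt0r_neq0 //.
have /(congr1 (fun m => m%:R : R)) := cardC [pred c | h (inr (i, j, c)) \in A].
rewrite natrD (card_ord M) => <-; rewrite addrAC subrr add0r; congr _%:R.
by apply: eq_card => c; rewrite !inE.
Qed.

Let UI_le h A B i j : (density h (A :&: B) i j <= density h A i j <= density h (A :|: B) i j) &&
  (density h (A :&: B) i j <= density h B i j <= density h (A :|: B) i j).
Proof. by rewrite !densityS ?subsetIl ?subsetIr ?subsetUl ?subsetUr. Qed.

Let hidden_valU h A B d : hidden_val delta (has_terminal h (A :|: B)) d =
  hidden_val delta (fun i => has_terminal h A i || has_terminal h B i) d.
Proof. by apply: eq_hidden_val => // i; rewrite /has_terminal inE. Qed.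

Let hidden_valI h A B d : hidden_val delta (has_terminal h (A :&: B)) d =
  hidden_val delta (fun i => has_terminal h A i && has_terminal h B i) d.
Proof. by apply: eq_hidden_val => // i; rewrite /has_terminal inE. Qed.

Lemma hidden_fun_ssmp h : ssmp_fun (hidden_fun h).
Proof.
split.
- by move=> S; apply: hidden_val_ge0 => // i j; apply: density01.
- move=> A B; rewrite /hidden_fun hidden_valU hidden_valI.
  have := @hidden_val_sub _ _ delta_gt0 delta_small _ k_gt0 (has_terminal h A) (has_terminal h B)
    (density h A) (density h B) (density h (A :&: B)) (density h (A :|: B)).
  apply.
  + by move=> i j; have /andP[] := density01 h (A :&: B) i j.
  + by move=> i j; have /andP[] := density01 h (A :|: B) i j.
  + by move=> i j; have /andP[] := UI_le h A B i j.
  + by move=> i j; have /andP[] := UI_le h A B i j.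
  + by move=> i j; apply: densityUI.
- move=> S; rewrite /hidden_fun -(hidden_val_compl _ k_gt0).
  apply: eq_hidden_val => [i|i j]; first by rewrite /has_terminal inE.
  by rewrite /compl_profile densityC.
Qed.

Lemma public_funE h S : public_fun h S = hidden_val delta (has_terminal h S) (sym_profile (density h S)).
Proof. by rewrite /public_fun profile_val_sym // => i j; apply: density01. Qed.

Lemma public_fun_ssmp h : ssmp_fun (public_fun h).
Proof.
split.
- move=> S; rewrite public_funE; apply: hidden_val_ge0 => // i j; rewrite /sym_profile.
  by have /andP[? ?] := density01 h S i j; have /andP[? ?] := density01 h S j i; apply/andP; split; lra.
- move=> A B; rewrite !public_funE hidden_valU hidden_valI.
  have := @hidden_val_sub _ _ delta_gt0 delta_small _ k_gt0 (has_terminal h A) (has_terminal h B)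
    (sym_profile (density h A)) (sym_profile (density h B))
    (sym_profile (density h (A :&: B))) (sym_profile (density h (A :|: B))).
  apply; move=> i j; rewrite /sym_profile.
  + by have /andP[? ?] := density01 h (A :&: B) i j; have /andP[? ?] := density01 h (A :&: B) j i; lra.
  + by have /andP[? ?] := density01 h (A :|: B) i j; have /andP[? ?] := density01 h (A :|: B) j i; lra.
  + have /andP[/andP[? ?] _] := UI_le h A B i j; have /andP[/andP[? ?] _] := UI_le h A B j i.
    by apply/andP; split; lra.
  + have /andP[_ /andP[? ?]] := UI_le h A B i j; have /andP[_ /andP[? ?]] := UI_le h A B j i.
    by apply/andP; split; lra.
  + have := densityUI h A B i j; have := densityUI h A B j i; lra.
- move=> S; rewrite !public_funE -(hidden_val_compl _ k_gt0).
  apply: eq_hidden_val => [i|i j]; first by rewrite /has_terminal inE.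
  by rewrite /compl_profile /sym_profile !densityC; lra.
Qed.

Lemma public_cost_ge h (L : {ffun 'I_n -> 'I_k}) : feasible (fun i => h (inl i)) L ->
  4 * k%:R - 64 <= cost (public_fun h) L.
Proof.
move=> feas.
have := @profile_lower_bound R k k_gt0 (fun l => density h (part L l)).
move=> /(_ _ _)/le_trans; apply.
- by move=> l i j; have /andP[] := density01 h (part L l) i j.
- move=> i j; rewrite /density -mulr_suml -natr_sum.
  have -> : (\sum_l #|[pred c | h (inr (i, j, c)) \in part L l]|)%N = M; last by rewrite divff ?lt0r_neq0.
  rewrite -[RHS]card_ord -sum1_card (partition_big (fun c => L (h (inr (i, j, c)))) xpredT) //=.
  by apply: eq_bigr => l _; rewrite -sum1_card; apply: eq_bigl => c; rewrite /part !inE.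
rewrite /cost le_eqVlt; apply/orP; left; apply/eqP; apply: eq_bigr => l _.
by apply: eq_profile_val => // i; rewrite /has_terminal /part !inE (feas i).
Qed.

Definition owner (x : site) : 'I_k := match x with inl i => i | inr p => p.1.1 end.

Lemma hidden_cost_le h : injective h -> exists2 L : {ffun 'I_n -> 'I_k},
  feasible (fun i => h (inl i)) L & 
  cost (hidden_fun h) L <= k%:R * (5 / 4 + star_weight R + 12 * delta) + star_weight R.
Proof.
move=> inj.
(* Elements that are not the image of a site affect no value and go to label 0. *)
pose L : {ffun 'I_n -> 'I_k} := [ffun v => if [pick x | h x == v] is Some x then owner x else Ordinal k_gt0].
have LE x : L (h x) = owner x.
  rewrite ffunE; case: pickP => [y /eqP/inj -> //|/(_ x)].
  by rewrite eqxx.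
exists L; first by move=> i; rewrite LE.
apply: le_trans (hidden_val_planted delta_gt0 k_gt0).
rewrite /cost le_eqVlt; apply/orP; left; apply/eqP; apply: eq_bigr => l _.
apply: eq_hidden_val => [i|i j]; first by rewrite /has_terminal /part !inE LE.
rewrite /density; case: eqP => [il|/eqP il].
  rewrite (@eq_card _ _ predT) ?card_ord ?divff ?lt0r_neq0 // => c.
  by rewrite /part !inE LE /= il eqxx.
rewrite (@eq_card _ _ pred0) ?card0 ?mul0r // => c.
by rewrite /part !inE LE /= (negbTE il).
Qed.

(* The bit at [(key i j, c)] exchanges (i, j, c) and (j, i, c). *)
Definition secret := {ffun 'I_k * 'I_k * 'I_M -> bool}.

(** A representative of the unordered pair, so that both orders read the same bits. *)
Definition key (i j : 'I_k) : 'I_k * 'I_k := if (i < j)%N then (i, j) else (j, i).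

Definition swap (sigma : secret) (x : site) : site :=
  match x with
  | inl i => inl i
  | inr (i, j, c) => inr (if sigma (key i j, c) then (j, i, c) else (i, j, c))
  end.

Lemma keyC i j : key i j = key j i.
Proof. by rewrite /key; case: ltngtP => // /val_inj ->. Qed.

Lemma swapK sigma : involutive (swap sigma).
Proof.
case=> [//|[[i j] c]] /=; case s: (sigma (key i j, c)) => /=; last by rewrite s.
by rewrite keyC s.
Qed.

Lemma density_swap h sigma S i j :
  density (h \o swap sigma) S i j + density (h \o swap sigma) S j i = density h S i j + density h S j i.
Proof.
have E (P : pred 'I_M) : #|[pred c | P c]| = (\sum_c P c)%N.
  by rewrite -sum1_card big_mkcond; apply: eq_bigr => c _; rewrite inE; case: (P c).
rewrite /density -!mulrDl -!natrD !E -!big_split /=.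
congr (_%:R / _); apply: eq_bigr => c _; rewrite (keyC j i).
by case: (sigma _) => //; rewrite addnC.
Qed.

Lemma hidden_public h sigma S :
  (forall i j, density (h \o swap sigma) S i j - density (h \o swap sigma) S j i <= delta) ->
  hidden_fun (h \o swap sigma) S = public_fun h S.
Proof.
move=> bal; rewrite /hidden_fun hidden_val_balanced //.
- by apply: eq_profile_val => // i j; apply: density_swap.
- by move=> i j; apply: density01.
- move=> i j; rewrite ler_norml; have := bal i j; have := bal j i => ? ?.
  by apply/andP; split; lra.
Qed.

End SetFunctions.

(** * Concentration *)

Section Concentration.
Variables (R : realType) (k M n : nat).
Local Notation site := ('I_k + 'I_k * 'I_k * 'I_M)%type.
Local Notation secret := (secret k M).
Implicit Types (h : site -> 'I_n) (S : {set 'I_n}).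

Lemma sum_secret_prod (kappa : 'I_k * 'I_k) (f : 'I_M -> bool -> R) :
  \sum_(sigma : secret) \prod_c f c (sigma (kappa, c)) =
  \prod_(e : 'I_k * 'I_k * 'I_M) (if e.1 == kappa then f e.2 true + f e.2 false else 2).
Proof.
pose F (e : 'I_k * 'I_k * 'I_M) (b : bool) : R := if e.1 == kappa then f e.2 b else 1.
have FE (sigma : secret) : \prod_c f c (sigma (kappa, c)) = \prod_e F e (sigma e).
  have -> : \prod_e F e (sigma e) = \prod_p \prod_c F (p, c) (sigma (p, c)).
    by rewrite pair_bigA; apply: eq_bigr => -[p c] _.
  rewrite (bigD1 kappa) //= [X in _ * X]big1 ?mulr1 => [|p pk].
    by apply: eq_bigr => c _; rewrite /F eqxx.
  by rewrite big1 // => c _; rewrite /F /= (negbTE pk).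
under eq_bigr do rewrite FE.
rewrite -(bigA_distr_bigA F); apply: eq_bigr => e _.
by rewrite big_bool /F; case: (e.1 == kappa).
Qed.

(** cosh (ln y), the mean of y^X for a uniform sign X. *)
Definition mean_cosh (y : R) : R := (y + y^-1) / 2.

Lemma mean_cosh_ge1 y : 0 < y -> 1 <= mean_cosh y.
Proof.
move=> y0; rewrite /mean_cosh ler_pdivlMr // -(ler_pM2r y0) mulrDl mulVf ?gt_eqF //.
have := sqr_ge0 (y - 1); lra.
Qed.

Variables (kappa : 'I_k * 'I_k) (u v : pred 'I_M).
(** [u] and [v] tell which elements of the two halves of a block lie in a fixed set; [U] and [V] are
    the same after the secret swaps. *)
Let U (sigma : secret) c := if sigma (kappa, c) then v c else u c.
Let V (sigma : secret) c := if sigma (kappa, c) then u c else v c.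
Let p sigma := #|[pred c | U sigma c && ~~ V sigma c]|.
Let r sigma := #|[pred c | V sigma c && ~~ U sigma c]|.

(** The moment generating function of p - r: by independence of the bits each c contributes a factor
    [mean_cosh y], or 1 where [u] and [v] agree. *)
Lemma mgf_bound y : 0 < y ->
  \sum_(sigma : secret) y ^+ p sigma * y^-1 ^+ r sigma <= #|{: secret}|%:R * mean_cosh y ^+ M.
Proof.
move=> y0; have y1 := mean_cosh_ge1 y0.
pose g (a b : bool) : R := (if a && ~~ b then y else 1) * (if b && ~~ a then y^-1 else 1).
pose f c (b : bool) : R := if b then g (v c) (u c) else g (u c) (v c).
have -> : \sum_(sigma : secret) y ^+ p sigma * y^-1 ^+ r sigma = \sum_(sigma : secret) \prod_c f c (sigma (kappa, c)).
  apply: eq_bigr => sigma _; rewrite /p /r -!prodr_const !(big_mkcond (fun i => i \in _)) -big_split /=.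
  by apply: eq_bigr => c _; rewrite !inE /f /g /U /V; case: (sigma _).
rewrite sum_secret_prod.
have -> : #|{: secret}|%:R * mean_cosh y ^+ M = \prod_(e : 'I_k * 'I_k * 'I_M) (2 * if e.1 == kappa then mean_cosh y else 1).
  rewrite big_split /= prodr_const card_ffun card_bool natrX; congr (_ * _).
  transitivity (\prod_q \prod_(c < M) (if q == kappa then mean_cosh y else 1)); last by rewrite pair_bigA.
  rewrite (bigD1 kappa) //= eqxx prodr_const card_ord [X in _ * X]big1 ?mulr1 // => q /negbTE ->.
  by rewrite big1.
apply: ler_prod => e _; rewrite /f /g.
have yV : 0 < y^-1 by rewrite invr_gt0.
have E : 2 * mean_cosh y = y + y^-1 by rewrite /mean_cosh; lra.
case: (e.1 == kappa); last by rewrite mulr1 lexx andbT.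
by case: (u _); case: (v _); rewrite /= ?mulr1 ?mul1r; apply/andP; split; lra.
Qed.

(** Chernoff: on the event p - r >= M / q the summand of [mgf_bound] at y = x^q is at least x^M. *)
Lemma tail_count (q : nat) (x : R) : 1 <= x ->
  #|[pred sigma : secret | (M + q * r sigma <= q * p sigma)%N]|%:R * x ^+ M <=
  #|{: secret}|%:R * mean_cosh (x ^+ q) ^+ M.
Proof.
move=> x1; have x0 : 0 < x by lra.
apply: le_trans (mgf_bound (exprn_gt0 q x0)).
rewrite (bigID [pred sigma : secret | (M + q * r sigma <= q * p sigma)%N]) /= -[leLHS]addr0 lerD //; last first.
  by rewrite sumr_ge0 // => sigma _; rewrite mulr_ge0 ?exprn_ge0 ?invr_ge0 ?exprn_ge0 ?ltW.
rewrite mulr_natl -sumr_const; apply: ler_sum => sigma; rewrite inE => hs.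
rewrite -!exprM -exprVn -exprM exprVn ler_pdivlMr ?exprn_gt0 // -exprD.
by apply: ler_weXn2l.
Qed.

Lemma card_diff sigma : (#|[pred c | U sigma c]| + r sigma = #|[pred c | V sigma c]| + p sigma)%N.
Proof.
have E (P : pred 'I_M) : #|[pred c | P c]| = (\sum_c P c)%N.
  by rewrite -sum1_card big_mkcond; apply: eq_bigr => c _; rewrite inE; case: (P c).
rewrite /p /r !E -!big_split; apply: eq_bigr => c _ /=.
by case: (U sigma c); case: (V sigma c).
Qed.

End Concentration.

(** * A union bound over the blocks *)

Section Unbalanced.
Variables (R : realType) (k M n q : nat).
Hypothesis M_gt0 : (0 < M)%N.
Hypothesis q_gt0 : (0 < q)%N.
Local Notation site := ('I_k + 'I_k * 'I_k * 'I_M)%type.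
Local Notation secret := (secret k M).
Variables (h : site -> 'I_n) (x : R).
Hypothesis x_ge1 : 1 <= x.

Definition unbalanced (S : {set 'I_n}) (sigma : secret) : bool :=
  [exists i, exists j, q%:R^-1 < density R (h \o swap sigma) S i j - density R (h \o swap sigma) S j i].

Lemma unbalanced_count S :
  #|[pred sigma | unbalanced S sigma]|%:R <= k%:R ^+ 2 * (#|{: secret}|%:R * (mean_cosh (x ^+ q) / x) ^+ M).
Proof.
have x0 : 0 < x by apply: lt_le_trans x_ge1.
pose bad i j := [pred sigma : secret | q%:R^-1 < density R (h \o swap sigma) S i j - density R (h \o swap sigma) S j i].
have hbad i j : #|bad i j|%:R <= #|{: secret}|%:R * (mean_cosh (x ^+ q) / x) ^+ M :> R.
  rewrite expr_div_n mulrA ler_pdivlMr ?exprn_gt0 //.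
  apply: le_trans (tail_count (key i j) [pred c | h (inr (i, j, c)) \in S] [pred c | h (inr (j, i, c)) \in S] q x_ge1).
  rewrite ler_pM2r ?exprn_gt0 // ler_nat; apply: subset_leq_card; apply/subsetP => sigma; rewrite !inE.
  have := card_diff (key i j) [pred c | h (inr (i, j, c)) \in S] [pred c | h (inr (j, i, c)) \in S] sigma.
  set r := #|[pred c | _ && _]|; set p := (X in (_ <= _ * X)%N).
  set a := #|_|; set b := (X in _ = (X + _)%N -> _).
  have -> : density R (h \o swap sigma) S i j = a%:R / M%:R.
    by congr (_%:R / _); apply: eq_card => c; rewrite !inE /=; case: (sigma _).
  have -> : density R (h \o swap sigma) S j i = b%:R / M%:R.
    by congr (_%:R / _); apply: eq_card => c; rewrite !inE /= (keyC j i); case: (sigma _).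
  move=> /(congr1 (fun m => m%:R : R)); rewrite !natrD => E.
  have M0 : 0 < M%:R :> R by rewrite ltr0n.
  have q0 : 0 < q%:R :> R by rewrite ltr0n.
  rewrite -mulrBl ltr_pdivlMr // -(ltr_pM2l q0) mulrA mulfV ?gt_eqF // mul1r => hlt.
  suff : (M + q * r)%:R <= (q * p)%:R :> R by rewrite ler_nat.
  rewrite natrD !natrM.
  have -> : p%:R = a%:R + r%:R - b%:R :> R by lra.
  lra.
have union : (#|[pred sigma | unbalanced S sigma]| <= \sum_(i < k) \sum_(j < k) #|bad i j|)%N.
  have E (P : pred secret) : #|P| = (\sum_sigma P sigma)%N.
    by rewrite -sum1_card big_mkcond; apply: eq_bigr => s _; rewrite unfold_in; case: (P s).
  under eq_bigr => i _ do under eq_bigr => j _ do rewrite E.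
  under eq_bigr => i _ do rewrite exchange_big /=.
  rewrite exchange_big /= E; apply: leq_sum => sigma _ /=.
  rewrite /unbalanced; case: existsP => // -[i /existsP[j hij]].
  by rewrite (bigD1 i) //= (bigD1 j) //= hij.
apply: (@le_trans _ _ (\sum_(i < k) \sum_(j < k) #|bad i j|)%:R); first by rewrite ler_nat.
rewrite natr_sum; apply: (@le_trans _ _ (\sum_(i < k) \sum_(j < k) (#|{: secret}|%:R * (mean_cosh (x ^+ q) / x) ^+ M))).
  by apply: ler_sum => i _; rewrite natr_sum; apply: ler_sum => j _; apply: hbad.
under eq_bigr do rewrite sumr_const card_ord.
by rewrite sumr_const card_ord -mulrnA -[leLHS]mulr_natl natrM expr2.
Qed.

End Unbalanced.

(** * Elementary estimates for powers *)

Section Growth.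
Variable R : realType.

Lemma expr1D_le (m : nat) (s : R) : 0 <= s -> m%:R * s <= 1 / 2 -> (1 + s) ^+ m <= 1 + 2 * (m%:R * s).
Proof.
move=> s0; elim: m => [|m IH]; first by rewrite expr0 mul0r mulr0 addr0.
rewrite -natr1 mulrDl mul1r => hm.
have m0 : 0 <= m%:R * s by rewrite mulr_ge0.
have {}IH : (1 + s) ^+ m <= 1 + 2 * (m%:R * s) by apply: IH; lra.
have s1 : 0 <= 1 + s by lra.
have h := ler_wpM2l s1 IH.
have h' : 0 <= s * (1 / 2 - m%:R * s) by rewrite mulr_ge0 //; lra.
rewrite exprS; move: h h'; move: (m%:R * s) ((1 + s) ^+ m) => a y; lra.
Qed.

Lemma expr_lt_ex (m : nat) (c : R) : 1 < c -> exists2 b : R, 1 < b & b ^+ m < c.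
Proof.
move=> c1; pose s := Num.min 1 (c - 1) / (4 * m.+1%:R).
have m0 : 0 < m.+1%:R :> R by [].
have u0 : 0 < Num.min 1 (c - 1) by rewrite lt_min ltr01 subr_gt0.
have s0 : 0 < s by rewrite divr_gt0 // mulr_gt0.
exists (1 + s); first lra.
have hs : m%:R * s <= Num.min 1 (c - 1) / 4.
  have -> : Num.min 1 (c - 1) / 4 = m.+1%:R * s.
    by rewrite /s; move: (m.+1%:R : R) m0 => D D0; field; rewrite gt_eqF.
  by rewrite ler_pM2r // ler_nat.
have := ge_min 1 1 (c - 1); have := ge_min (c - 1) 1 (c - 1); rewrite !lexx orbT => h1 h2.
have := @expr1D_le m s (ltW s0); lra.
Qed.

(** For x = 1 + s the numerator exceeds 1 only to second order. With s = 1 / (4 q^2), z = x^q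
    satisfies (z - 1)^2 <= s, and the numerator is at most 1 + s / 2. *)
Lemma mean_cosh_expr_ex (q : nat) : (0 < q)%N -> exists2 x : R, 1 < x & mean_cosh (x ^+ q) / x < 1.
Proof.
move=> q0; have Q1 : 1 <= q%:R :> R by rewrite ler1n.
have Q0 : 0 < q%:R :> R by lra.
pose s : R := (4 * q%:R ^+ 2)^-1.
have s0 : 0 < s by rewrite invr_gt0 mulr_gt0 // exprn_gt0.
have qs : q%:R * s = (4 * q%:R)^-1 by rewrite /s; field; rewrite gt_eqF.
have i1 : (4 * q%:R)^-1 <= 1 / 4 :> R.
  by rewrite invfM -[leRHS]mulr1 mul1r ler_pM2l ?invr_gt0 // invf_le1.
exists (1 + s); first lra.
rewrite ltr_pdivrMr ?mul1r; last lra.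
have hz : (1 + s) ^+ q <= 1 + 2 * (q%:R * s) by apply: expr1D_le; rewrite ?(ltW s0) // qs; lra.
have z1 : 1 <= (1 + s) ^+ q by apply: exprn_ege1; lra.
move: hz z1; set z := (1 + s) ^+ q => hz z1.
have z0 : 0 < z by lra.
have sq : (z - 1) ^+ 2 <= s.
  have -> : s = (2 * (q%:R * s)) ^+ 2 by rewrite qs /s; field; rewrite gt_eqF.
  by rewrite lerXn2r ?nnegrE; lra.
have zV : z^-1 <= 1 - (z - 1) + (z - 1) ^+ 2.
  rewrite -[leLHS]mul1r ler_pdivrMr //.
  have : 0 <= (z - 1) ^+ 3 by rewrite exprn_ge0 // subr_ge0.
  lra.
rewrite /mean_cosh; lra.
Qed.

Lemma expr_decay (rho C eps : R) : 0 < rho -> rho < 1 -> 0 <= C -> 0 < eps ->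
  exists M0 : nat, forall M, (M0 <= M)%N -> C * rho ^+ M <= eps.
Proof.
move=> r0 r1 C0 e0; pose s := rho^-1 - 1.
have s0 : 0 < s by rewrite subr_gt0 invf_gt1.
have bern (m : nat) : 1 + m%:R * s <= (1 + s) ^+ m.
  elim: m => [|m IH]; first by rewrite mul0r addr0 expr0.
  have s1 : 0 <= 1 + s by lra.
  have h := ler_wpM2l s1 IH; rewrite exprS -natr1.
  have : 0 <= m%:R * s * s by rewrite !mulr_ge0 // ltW.
  lra.
have es0 : 0 <= C / (eps * s) by rewrite divr_ge0 // ltW // mulr_gt0.
exists (Num.bound (C / (eps * s))) => M hM.
have hb := archi_boundP es0.
have hM' : C / (eps * s) <= M%:R by apply: ltW; apply: (lt_le_trans hb); rewrite ler_nat.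
rewrite ler_pdivrMr ?mulr_gt0 // in hM'.
have -> : rho = (1 + s)^-1 by rewrite /s addrC subrK invrK.
rewrite exprVn ler_pdivrMr ?exprn_gt0 //; last lra.
have := ler_wpM2l (ltW e0) (bern M); lra.
Qed.

End Growth.

(** * Oracle algorithms *)

Section Oracle.
Variables (R : realType) (n k : nat).
Implicit Types (f g : {set 'I_n} -> R) (T : oracle_tree R n k).

Fixpoint asked f T : seq {set 'I_n} :=
  match T with
  | Output _ => [::]
  | Query Q c => Q :: asked f (c (f Q))
  end.

Lemma size_asked f T : size (asked f T) = queries f T.
Proof. by elim: T => //= Q c IH; rewrite IH. Qed.

Lemma run_eq f g T : {in asked g T, f =1 g} -> run f T = run g T.
Proof.
elim: T => //= Q c IH fg; rewrite fg ?mem_head //; apply: IH => S hS; apply: fg.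
by rewrite inE hS orbT.
Qed.

Lemma ler_sum_In (T : Type) (d : seq T) (F G : T -> R) :
  (forall p, List.In p d -> F p <= G p) -> \sum_(p <- d) F p <= \sum_(p <- d) G p.
Proof.
elim: d => [|a d IH] h; first by rewrite !big_nil.
by rewrite !big_cons lerD ?h ?IH //=; [left|move=> p hp; apply: h; right].
Qed.

Lemma In_dichotomy (T : Type) (P : pred T) (d : seq T) :
  (exists p, List.In p d /\ P p) \/ (forall p, List.In p d -> ~~ P p).
Proof.
elim: d => [|a d [[p [hp Pp]]|IH]]; first by right.
  by left; exists p; split; [right|].
case: (boolP (P a)) => Pa; first by left; exists a; split; [left|].
by right => p /= [<-|/IH].
Qed.

End Oracle.

(** * Oracle algorithms against a random secret *)

Section Hardness.
Variables (R : realType) (k M n q : nat) (x : R).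
Hypothesis k_gt0 : (0 < k)%N.
Hypothesis M_gt0 : (0 < M)%N.
Hypothesis q_gt0 : (0 < q)%N.
Hypothesis x_ge1 : 1 <= x.
Local Notation site := ('I_k + 'I_k * 'I_k * 'I_M)%type.
Local Notation secret := (secret k M).
Variable h : site -> 'I_n.
Let g := public_fun R h.

(* Querying also the parts of the output makes its cost part of what is observed. *)
Definition probes (T : oracle_tree R n k) : seq {set 'I_n} :=
  asked g T ++ [seq part (run g T) l | l <- enum 'I_k].

Definition caught (T : oracle_tree R n k) (sigma : secret) : bool :=
  has (fun S => unbalanced R q h S sigma) (probes T).

Let rate : R := k%:R ^+ 2 * (mean_cosh (x ^+ q) / x) ^+ M.

Lemma caught_count T : \sum_(sigma : secret) (caught T sigma)%:R <=
  ((queries g T)%:R + k%:R) * rate * #|{: secret}|%:R.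
Proof.
have -> : (queries g T)%:R + k%:R = \sum_(S <- probes T) 1 :> R.
  by rewrite big_const_seq count_predT iter_addr_0 size_cat size_map size_enum_ord size_asked natrD.
rewrite -mulrA mulr_suml.
apply: (@le_trans _ _ (\sum_(S <- probes T) \sum_(sigma : secret) (unbalanced R q h S sigma)%:R)).
  rewrite exchange_big /=; apply: ler_sum => sigma _; rewrite /caught.
  elim: (probes T) => [|S s IH]; first by rewrite big_nil.
  rewrite big_cons /=; case: (unbalanced _ _ _ _ _) => /=; last by rewrite add0r.
  by rewrite lerDl sumr_ge0.
apply: ler_sum => S _; rewrite mul1r.
have := unbalanced_count M_gt0 q_gt0 h x_ge1 S.
rewrite -sum1_card natr_sum big_mkcond /=.
rewrite (eq_bigr (fun sigma => (unbalanced R q h S sigma)%:R)) => [|s _].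
  by move/le_trans; apply; rewrite /rate mulrCA mulrC.
by rewrite inE; case: (unbalanced _ _ _ _ _).
Qed.

(** Averaging over all secrets gives one that works for the whole distribution of trees; trees of
    weight 0 contribute nothing. *)
Lemma exists_secret (d : seq (R * oracle_tree R n k)) (Q : R) : is_distr d ->
  (forall p, List.In p d -> 0 < p.1 -> (queries g p.2)%:R <= Q) ->
  exists sigma : secret, \sum_(p <- d) p.1 * (caught p.2 sigma)%:R <= (Q + k%:R) * rate.
Proof.
move=> [d0 d1] hQ.
have rate0 : 0 <= rate.
  rewrite mulr_ge0 ?exprn_ge0 // divr_ge0 ?(le_trans ler01) //.
  by rewrite mean_cosh_ge1 // exprn_gt0 // (lt_le_trans ltr01).
have N0 : (0 < #|{: secret}|)%N by rewrite card_ffun card_bool expn_gt0.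
have avg : \sum_(sigma : secret) \sum_(p <- d) p.1 * (caught p.2 sigma)%:R <= (Q + k%:R) * rate * #|{: secret}|%:R.
  rewrite exchange_big /=.
  apply: (@le_trans _ _ (\sum_(p <- d) p.1 * ((Q + k%:R) * rate * #|{: secret}|%:R))); last by rewrite -mulr_suml d1 mul1r.
  apply: ler_sum_In => p hp; rewrite -mulr_sumr.
  have := d0 _ hp; rewrite le_eqVlt => /orP[/eqP <-|p0]; first by rewrite !mul0r.
  rewrite ler_pM2l //; apply: le_trans (caught_count _) _.
  by rewrite ler_wpM2r // ler_wpM2r // lerD2r hQ.
case: (pickP [pred sigma : secret | \sum_(p <- d) p.1 * (caught p.2 sigma)%:R <= (Q + k%:R) * rate]) => [s hs|none]; first by exists s.
have [s0 _] : exists s : secret, true by move/card_gt0P: N0 => [s _]; exists s.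
suff : (Q + k%:R) * rate * #|{: secret}|%:R < \sum_(sigma : secret) \sum_(p <- d) p.1 * (caught p.2 sigma)%:R.
  by rewrite ltNge avg.
rewrite mulr_natr -sumr_const; apply: ltr_sum; first by apply/hasP; exists s0; rewrite ?mem_index_enum.
by move=> s _; rewrite ltNge; apply/negP => hs; have := none s; rewrite /= hs.
Qed.

(** All probed sets are balanced for this secret, so each answer is the public one. *)
Lemma run_uncaught delta T sigma : q%:R^-1 = delta -> 0 < delta -> ~~ caught T sigma ->
  run (hidden_fun delta (h \o swap sigma)) T = run g T /\
  cost (hidden_fun delta (h \o swap sigma)) (run g T) = cost g (run g T).
Proof.
move=> dq dl; rewrite /caught -all_predC => /allP hall.
have agree S : S \in probes T -> hidden_fun delta (h \o swap sigma) S = g S.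
  move=> /hall /= hS; apply: hidden_public => // i j; rewrite -dq leNgt.
  by apply: contra hS => hij; apply/existsP; exists i; apply/existsP; exists j.
split; first by apply: run_eq => S hS; apply: agree; rewrite mem_cat hS.
by apply: eq_bigr => l _; apply: agree; rewrite mem_cat map_f ?orbT // mem_enum.
Qed.

Lemma expected_cost_ge delta (A : rand_alg R n k) alpha sigma (t := fun i => h (inl i)) :
  q%:R^-1 = delta -> 0 < delta -> delta <= 1 / 1000 -> injective h -> (16 <= k)%N ->
  approx_alg A alpha ->
  (1 - \sum_(p <- A t) p.1 * (caught p.2 sigma)%:R) * (4 * k%:R - 64) <=
  expected_cost (hidden_fun delta (h \o swap sigma)) (A t).
Proof.
move=> dq dl ds inj k16 approx.
have ssmp := @hidden_fun_ssmp R delta k M n dl ds k_gt0 M_gt0 (h \o swap sigma).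
have tinj : injective t by move=> i j /inj [].
have [[d0 d1] feas _] := approx t _ tinj ssmp.
have K16 : 16 <= k%:R :> R by rewrite (ler_nat R 16 k).
have -> : 1 - \sum_(p <- A t) p.1 * (caught p.2 sigma)%:R =
    \sum_(p <- A t) (p.1 - p.1 * (caught p.2 sigma)%:R) by rewrite sumrB d1.
rewrite mulr_suml; apply: ler_sum_In => p hp.
have := d0 _ hp; rewrite le_eqVlt => /orP[/eqP <-|p0]; first by rewrite !mul0r subr0 mul0r.
have -> : p.1 - p.1 * (caught p.2 sigma)%:R = p.1 * (1 - (caught p.2 sigma)%:R) by ring.
rewrite -mulrA ler_pM2l //.
have hf := feas _ hp p0.
case: (boolP (caught p.2 sigma)) => [_|unc].
  rewrite subrr mul0r sumr_ge0 // => l _; by have [nn _ _] := ssmp; apply: nn.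
have [E1 E2] := run_uncaught dq dl unc.
rewrite subr0 mul1r E1 E2; apply: public_cost_ge => //.
by rewrite -E1.
Qed.

End Hardness.

(** * Choice of parameters and the exponential lower bound *)

Theorem theorem4 (R : realType) :
  exists k0 : nat, forall k : nat, (k0 <= k)%N ->
  forall alpha : R, alpha < 1268%:R / 1000%:R ->
  exists b : R, 1 < b /\
  exists N : nat, forall n : nat, (N <= n)%N ->
  forall A : rand_alg R n k, approx_alg A alpha ->
  exists (t : 'I_k -> 'I_n) (f : {set 'I_n} -> R),
    [/\ injective t, ssmp_fun f &
        exists p, [/\ Stdlib.Lists.List.In p (A t), 0 < p.1 & b ^+ n <= (queries f p.2)%:R]].
Proof.
have B0 : 0 <= 10 ^+ 6 :> R by rewrite exprn_ge0.
(* [q] is both 1 / delta and the least k. *)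
pose q := Num.bound (10 ^+ 6 : R); have hq : 10 ^+ 6 < q%:R := archi_boundP B0.
exists q => k kq alpha halpha.
have hK : 10 ^+ 6 < k%:R :> R by apply: lt_le_trans hq _; rewrite ler_nat.
have q_gt0 : (0 < q)%N by rewrite -(ltr_nat R); lra.
have k_gt0 : (0 < k)%N by apply: leq_trans kq.
have k16 : (16 <= k)%N by rewrite -(ler_nat R); lra.
have [x x1 hx] := mean_cosh_expr_ex R q_gt0.
have x0 : 0 < x by lra.
set rho := mean_cosh (x ^+ q) / x in hx.
have rho0 : 0 < rho.
  by rewrite divr_gt0 // (lt_le_trans ltr01) // mean_cosh_ge1 // exprn_gt0.
(* A set is unbalanced with probability O(rho^M), and n is about k^2 M; this choice lets b^n queries
   still fail with vanishing probability. *)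
have [b b1 hb] : exists2 b : R, 1 < b & b ^+ (k * k) < rho^-1 by apply: expr_lt_ex; rewrite invf_gt1.
have b0 : 0 < b by lra.
exists b; split => //.
pose C : R := (1 + k%:R) * k%:R ^+ 2 * b ^+ (k + k * k).
have C0 : 0 <= C by rewrite !mulr_ge0 ?exprn_ge0 ?addr_ge0 // ltW.
have e0 : 0 < 10 ^- 5 :> R by rewrite invr_gt0 exprn_gt0.
have rho'0 : 0 < b ^+ (k * k) * rho by rewrite mulr_gt0 ?exprn_gt0.
have rho'1 : b ^+ (k * k) * rho < 1 by rewrite -(mulVf (lt0r_neq0 rho0)) ltr_pM2r.
have [M0 hM0] := expr_decay rho'0 rho'1 C0 e0.
exists (k + M0.+1 * (k * k))%N => n hn A approx.
have kk0 : (0 < k * k)%N by rewrite muln_gt0 k_gt0.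
pose M := ((n - k) %/ (k * k))%N.
have MM0 : (M0 < M)%N by rewrite leq_divRL // leq_subRL // (leq_trans _ hn) // leq_addr.
have M_gt0 : (0 < M)%N by apply: leq_trans MM0.
have kn : (k <= n)%N by apply: leq_trans hn; apply: leq_addr.
have card_site : (#|{: 'I_k + 'I_k * 'I_k * 'I_M}| <= n)%N.
  by rewrite card_sum !card_prod !card_ord -leq_subRL // mulnC leq_divM.
have nle : (n <= (k + k * k) + (k * k) * M)%N.
  have := ltn_ceil (n - k) kk0; rewrite -/M ltn_subLR // => /ltnW h.
  by apply: leq_trans h _; rewrite -addnA leq_add2l mulSn mulnC.
pose h (y : 'I_k + 'I_k * 'I_k * 'I_M) : 'I_n := widen_ord card_site (enum_rank y).
have inj : injective h by move=> y z /(congr1 val) /= /val_inj /enum_rank_inj.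
(* The instance that forces many queries is the public one; the planted instances serve to refute an
   algorithm that asks few. *)
exists (fun i => h (inl i)), (public_fun R h).
pose delta : R := q%:R^-1.
have q0 : 0 < q%:R :> R by rewrite ltr0n.
have delta0 : 0 < delta by rewrite invr_gt0.
have hdelta : delta * 10 ^+ 6 <= 1 by rewrite mulrC ler_pdivrMr // mul1r ltW.
have delta_small : delta <= 1 / 1000 by lra.
split; first by move=> i j /inj [].
  exact: (public_fun_ssmp delta0 delta_small k_gt0 M_gt0).
case: (In_dichotomy (fun p => (0 < p.1) && (b ^+ n <= (queries (public_fun R h) p.2)%:R)) (A (fun i => h (inl i)))).
  by move=> [p [hp /andP[p0 pb]]]; exists p.
move=> few; exfalso.
have ssmp := @hidden_fun_ssmp R delta k M n delta0 delta_small k_gt0 M_gt0.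
have tinj : injective (fun i => h (inl i)) by move=> i j /inj [].
have [distr _ _] := approx _ _ tinj (ssmp h).
have few' p : List.In p (A (fun i => h (inl i))) -> 0 < p.1 -> (queries (public_fun R h) p.2)%:R <= b ^+ n.
  by move=> hp p0; have := few _ hp; rewrite p0 /= -ltNge => /ltW.
have [sigma hsigma] := exists_secret M_gt0 q_gt0 (ltW x1) distr few'.
have failure : \sum_(p <- A (fun i => h (inl i))) p.1 * (caught q h p.2 sigma)%:R <= 10 ^- 5.
  apply: le_trans hsigma _; apply: le_trans (hM0 M (ltnW MM0)).
  have bn : b ^+ n <= b ^+ (k + k * k) * (b ^+ (k * k)) ^+ M.
    by rewrite -exprM -exprD; apply: ler_weXn2l => //; apply: ltW.
  have bn1 : 1 <= b ^+ n by apply: exprn_ege1; apply: ltW.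
  have -> : C * (b ^+ (k * k) * rho) ^+ M =
    (1 + k%:R) * (b ^+ (k + k * k) * (b ^+ (k * k)) ^+ M) * (k%:R ^+ 2 * rho ^+ M).
    by rewrite /C exprMn; ring.
  rewrite -/rho ler_wpM2r //; first by rewrite mulr_ge0 ?exprn_ge0 ?(ltW rho0).
  apply: (@le_trans _ _ ((1 + k%:R) * b ^+ n)); last by rewrite ler_wpM2l // addr_ge0.
  by rewrite mulrDl mul1r lerD2l ler_peMr.
have lower := expected_cost_ge k_gt0 M_gt0 (q := q) sigma (erefl delta) delta0 delta_small inj k16 approx.
have inj' : injective (h \o swap sigma) by apply: inj_comp inj (inv_inj (swapK sigma)).
have [L feasL costL] := hidden_cost_le delta0 k_gt0 M_gt0 inj'.
have [_ _ /(_ L feasL) upper] := approx _ _ tinj (ssmp (h \o swap sigma)).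
have cost0 : 0 <= cost (hidden_fun delta (h \o swap sigma)) L.
  by rewrite sumr_ge0 // => l _; have [nn _ _] := ssmp (h \o swap sigma); apply: nn.
have alphaL := ler_wpM2r cost0 (ltW halpha).
have kdelta : k%:R * (delta * 10 ^+ 6) <= k%:R :> R by rewrite ler_piMr.
have K64 : 0 <= 4 * k%:R - 64 :> R by lra.
have lower' : (1 - 10 ^- 5) * (4 * k%:R - 64) <= alpha * cost (hidden_fun delta (h \o swap sigma)) L.
  by apply: le_trans upper; apply: le_trans lower; rewrite ler_wpM2r // lerD2l lerN2.
(* 4 / (5/4 + beta) exceeds 1.268 by a relative 7 * 10^-5. The failure probability, the 64 and the
   terms in delta and beta / k lose about 3 * 10^-5. *)
move: lower' alphaL costL kdelta hK; rewrite /star_weight.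
move: (cost _ L) (alpha * _) => c ac; lra.
Qed.
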